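(* Let $(T_1,T_2,T)$ be a tetrablock contraction on a Hilbert space $\mathcal H$ and let $F_1,F_2\in\mathcal B(\mathcal D_T)$ be its fundamental operators. If $(T_1,T_2,T)$ has a tetrablock-isometric lift, then each of the following holds: (1) There exist a Hilbert space $\mathcal F$, an isometry $\Lambda:\mathcal D_T\to\mathcal F$ and a commuting pair $(S_1,S_2)$ of bounded operators on $\mathcal F$ such that $F_i=\Lambda^*S_i\Lambda$ for $i=1,2$, and $(S_1,S_2)$ extends to a commuting pair $(N_1,N_2)$ of normal operators on a Hilbert space containing $\mathcal F$ (i.e. $\mathcal F$ is invariant under $N_i$ and $N_i|_{\mathcal F}=S_i$ for $i=1,2$) whose joint spectrum satisfies $\sigma(N_1,N_2)\subset\{(z_1,z_2)\in\mathbb C^2:|z_1|=|z_2|\le1\}$. (2) $(F_1^*D_TT_1-F_2^*D_TT_2)|_{\operatorname{Ker}D_T}=0$. (3) $(F_1^*F_2^*-F_2^*F_1^* )D_TT|_{\operatorname{Ker}D_T}=0$.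
   Context: All operators are bounded linear operators on complex Hilbert spaces; $\mathcal B(\mathcal X)$ denotes the bounded operators on $\mathcal X$. The tetrablock is the domain $\mathbb E\subset\mathbb C^3$ of all $(x_1,x_2,x_3)$ for which there is a matrix $A=\begin{bmatrix} a_{11} & a_{12} \\ a_{21} & a_{22} \end{bmatrix}\in\mathbb C^{2\times2}$ with operator norm $\|A\|<1$ and $x_1=a_{11}$, $x_2=a_{22}$, $x_3=\det A$. Its distinguished boundary is $\{(x_1,x_2,x_3)\in\mathbb C^3: x_1=\overline{x_2}x_3,\ |x_2|\le1,\ |x_3|=1\}$. A tetrablock contraction on a Hilbert space $\mathcal H$ is a commuting triple $(T_1,T_2,T)$ of operators on $\mathcal H$ having $\mathbb E$ as a spectral set, that is, $\|f(T_1,T_2,T)\|\le\sup_{x\in\mathbb E}|f(x)|$ for every polynomial $f$ in three variables. A tetrablock unitary is a commuting triple of normal operators whose joint (Taylor) spectrum is contained in the distinguished boundary of $\mathbb E$. A tetrablock isometry on $\mathcal K$ is a commuting triple $(V_1,V_2,V)$ on $\mathcal K$ for which there is a tetrablock unitary $(U_1,U_2,U)$ on a Hilbert space $\widetilde{\mathcal K}\supset\mathcal K$ such that $\mathcal K$ is invariant under $U_1,U_2,U$ and $V_1=U_1|_{\mathcal K}$, $V_2=U_2|_{\mathcal K}$, $V=U|_{\mathcal K}$. A commuting triple $(T_1,T_2,T)$ on $\mathcal H$ has a tetrablock-isometric lift if there is a tetrablock isometry $(V_1,V_2,V)$ on some Hilbert space $\mathcal K\supset\mathcal H$ such that $\mathcal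 H$ is invariant under $V_1^*,V_2^*,V^*$ and $T_1^*=V_1^*|_{\mathcal H}$, $T_2^*=V_2^*|_{\mathcal H}$, $T^*=V^*|_{\mathcal H}$. For a contraction $T$, $D_T=(I-T^*T)^{1/2}$ and $\mathcal D_T=\overline{\operatorname{Ran}}\,D_T$. For a tetrablock contraction $(T_1,T_2,T)$, it is known that there are unique bounded operators $F_1,F_2$ on $\mathcal D_T$ with $T_1-T_2^*T=D_TF_1D_T$ and $T_2-T_1^*T=D_TF_2D_T$; these are called the fundamental operators of $(T_1,T_2,T)$. *)

(* Defs.v *)
From HB Require Import structures.
From mathcomp Require Import all_boot all_order all_algebra.
From mathcomp Require Import all_classical all_reals all_analysis.
From mathcomp Require Import complex.
From mathcomp Require mpoly.

Set Implicit Arguments.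
Unset Strict Implicit.
Unset Printing Implicit Defensive.

Import Order.TTheory GRing.Theory Num.Theory.
Import numFieldNormedType.Exports.
Local Open Scope classical_set_scope.
Local Open Scope ring_scope.
Local Open Scope complex_scope.

(** The inner product is linear in its first argument; norms are nonnegative
    elements of [R[i]]. *)
HB.mixin Record NormedModule_isHilbert (R : realType) H
    & CompleteNormedModule R[i] H := {
  inner : {dot H for (@Num.conj R[i])} ;
  inner_norm : forall x : H, inner x x = `|x| ^+ 2
}.

#[short(type="hilbertType")]
HB.structure Definition Hilbert (R : realType) :=
  {H of CompleteNormedModule R[i] H & NormedModule_isHilbert R H}.

Section closed_subspaces.
Variables (R : realType) (H : hilbertType R).

Record closedSubspace := ClosedSubspace {
  cs_set :> set H ;
  cs_submod : submod_closed (fun x : H => x \in cs_set) ;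
  cs_closed : closed cs_set
}.

Definition cs_pred (W : closedSubspace) : pred H := fun x => x \in cs_set W.

HB.instance Definition _ (W : closedSubspace) :=
  GRing.isSubmodClosed.Build R[i] H (cs_pred W) (cs_submod W).

Inductive csType (W : closedSubspace) := CsType (x : H) of cs_pred W x.

Section structure.
Variable W : closedSubspace.

Definition cs_val (x : csType W) : H := let: CsType y _ := x in y.

HB.instance Definition _ := [isSub for cs_val].
HB.instance Definition _ := [Choice of csType W by <:].
HB.instance Definition _ := [SubChoice_isSubLmodule of csType W by <:].

Let nrm (x : csType W) : R[i] := `|val x|.
Let nrmD x y : nrm (x + y) <= nrm x + nrm y.
Proof. exact: ler_normD. Qed.
Let nrmZ (l : R[i]) x : nrm (l *: x) = `|l| * nrm x.
Proof. exact: normrZ. Qed.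
Let nrm0 x : nrm x = 0 -> x = 0.
Proof. by move=> /eqP; rewrite normr_eq0 => /eqP x0; apply: val_inj. Qed.

HB.instance Definition _ := @Lmodule_isNormed.Build R[i] (csType W) nrm nrmD nrmZ nrm0.

Let cs_complete (F : set_system (csType W)) :
  ProperFilter F -> cauchy F -> cvg F.
Proof.
move=> FF /cauchyP Fc.
have Gc : cauchy (val @ F : set_system H).
  apply/cauchy_exP => e e0; have [x Fx] := Fc _ e0.
  exists (val x); rewrite /= /nbhs /=; apply: filterS Fx => y.
  by rewrite -!ball_normE.
have GF := fmap_proper_filter val FF.
have /cvg_ex[l Gl] := @cauchy_cvg _ _ GF Gc.
have Wl : cs_pred W l.
  apply/mem_set; apply: (@closed_cvg _ _ _ FF val (cs_set W) (@cs_closed W)) Gl.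
  by apply: nearW => -[x Wx]; exact: set_mem Wx.
apply/cvg_ex; exists (CsType Wl).
by apply/cvgrPdist_lt => e e0; have /cvgrPdist_lt/(_ e e0) := Gl.
Qed.

HB.instance Definition _ := Uniform_isComplete.Build (csType W) cs_complete.

Let cs_inner (x y : csType W) : R[i] := inner (val x) (val y).
Let cs_inner_linear :
  bilinear_for (GRing.Scale.Law.clone _ _ *%R _)
    (GRing.Scale.Law.clone _ _ (@Num.conj R[i] \; *%R) _) cs_inner.
Proof.
split=> u a x y; rewrite /cs_inner linearP /=; [exact: linearPl|by []].
Qed.
Let cs_inner_conj x y : cs_inner x y = (-1) ^+ false * Num.conj (cs_inner y x).
Proof. exact: hermC. Qed.
Let cs_inner_gt0 x : x != 0 -> 0 < cs_inner x x.
Proof. by move=> x0; rewrite /cs_inner inner_norm exprn_gt0 ?normr_gt0. Qed.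
Let cs_inner_norm x : cs_inner x x = `|x| ^+ 2.
Proof. exact: inner_norm. Qed.

HB.instance Definition _ := bilinear_isBilinear.Build _ _ _ _ _ _ cs_inner
  cs_inner_linear.
HB.instance Definition _ := isHermitianSesquilinear.Build _ _ false
  (@Num.conj R[i]) cs_inner cs_inner_conj.
HB.instance Definition _ := isDotProduct.Build _ _ cs_inner cs_inner_gt0.
HB.instance Definition _ := NormedModule_isHilbert.Build R (csType W)
  cs_inner_norm.

End structure.
End closed_subspaces.

Record bop (R : realType) (H K : hilbertType R) := Bop {
  bop_fun :> {linear H -> K} ;
  bop_continuous : continuous bop_fun
}.

Section operators.
Variable R : realType.
Implicit Types H K : hilbertType R.

(** The Hilbert-space adjoint. At a bounded [A] the vector exists by the Riesz
    representation theorem, and it is unique. *)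
Definition adjoint H K (A : bop H K) (y : K) : H :=
  get [set x : H | forall h : H, inner (A h) y = inner h x].

Definition isometric_op H K (A : bop H K) := forall x : H, `|A x| = `|x|.

Definition normal_op H (A : bop H H) :=
  forall x : H, adjoint A (A x) = A (adjoint A x).

Definition positive_op H (A : bop H H) := forall x : H, 0 <= inner (A x) x.

Definition commuting H n (A : n.-tuple (bop H H)) :=
  forall (i j : 'I_n) (x : H), tnth A i (tnth A j x) = tnth A j (tnth A i x).

(** Extended-real valued so that no boundedness condition is hidden in [sup]. *)
Definition op_norm H K (A : H -> K) : \bar R :=
  ereal_sup [set (complex.Re `|A x|)%:E | x in [set x : H | `|x| <= 1]].

Lemma closure_range_submod H K (D : bop H K) :
  submod_closed (fun y : K => y \in closure (range D)).
Proof.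
split=> [|a u v].
  by apply/mem_set/subset_closure; exists 0 => //; rewrite linear0.
move=> /set_mem Du /set_mem Dv; apply/mem_set.
have Cf : {for (u, v), continuous (fun z : K * K => a *: z.1 + z.2)}.
  by apply: cvgD; [apply: cvgZl_tmp; exact: cvg_fst|exact: cvg_snd].
move=> B /Cf[[P Q] /= [/Du[_ [[x _ <-] Px]] /Dv[_ [[y _ <-] Qy]]] PQB].
exists (a *: D x + D y); split; last exact: (PQB (D x, D y)).
by exists (a *: x + y) => //; rewrite linearP.
Qed.

Definition closure_range H K (D : bop H K) : closedSubspace K :=
  ClosedSubspace (closure_range_submod D) (@closed_closure _ _).

Lemma closure_range_mem H K (D : bop H K) (x : H) :
  cs_pred (closure_range D) (D x).
Proof. by apply/mem_set/subset_closure; exists x. Qed.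

Definition corestrict H K (D : bop H K) (x : H) : csType (closure_range D) :=
  CsType (closure_range_mem D x).

(** The Koszul complex of an n-tuple [A] on [H]: a cochain in
    [H] (x) [/\ C^n] is given by its components [w I] along e_I, for
    [I : {set 'I_n}], and the differential is sum_i A_i (x) (e_i /\ -). *)
Definition koszul H n (A : 'I_n -> H -> H) (w : {set 'I_n} -> H) :
    {set 'I_n} -> H := fun I =>
  \sum_(i in I) (-1) ^+ #|[set j in I | (j < i)%N]| *: A i (w (I :\ i)%SET).

Definition koszul_exact H n (A : 'I_n -> H -> H) :=
  forall w : {set 'I_n} -> H,
    (forall I, koszul A w I = 0) -> exists v, forall I, w I = koszul A v I.

Definition taylor_spectrum H n (A : n.-tuple (bop H H)) : set (n.-tuple R[i]) :=
  [set z | ~ koszul_exact (fun i (x : H) => tnth A i x - tnth z i *: x)].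

End operators.

Section tetrablock.
Variable R : realType.
Implicit Types H K L : hilbertType R.

Definition l2norm n (v : 'cV[R[i]]_n) : R :=
  Num.sqrt (\sum_i complex.Re `|v i ord0| ^+ 2).

Definition mx_op_norm n (A : 'M[R[i]]_n) : \bar R :=
  ereal_sup [set (l2norm (A *m v))%:E | v in [set v | l2norm v <= 1]].

Definition tetrablock : set (3.-tuple R[i]) :=
  [set x | exists2 A : 'M[R[i]]_2, (mx_op_norm A < 1)%E &
     x = [tuple A 0 0; A 1 1; \det A]].

Definition tetrablock_dist_boundary : set (3.-tuple R[i]) :=
  [set x | [/\ tnth x 0 = (tnth x 1)^* * tnth x 2,
     `|tnth x 1| <= 1 & `|tnth x 2| = 1]].

(** [p(A_0, ..., A_(n-1))], meant for a commuting tuple [A] *)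
Definition poly_op H n (A : n.-tuple (bop H H)) (p : mpoly.mpoly n R[i]) (x : H) : H :=
  \sum_(m <- mpoly.msupp p) mpoly.mcoeff m p *:
    foldr (fun (i : 'I_n) (y : H) => iter (mpoly.fun_of_multinom m i) (tnth A i) y) x (enum 'I_n).

Definition spectral_set H n (A : n.-tuple (bop H H)) (X : set (n.-tuple R[i])) :=
  forall p : mpoly.mpoly n R[i],
    (op_norm (poly_op A p) <=
     ereal_sup [set (complex.Re `|mpoly.meval (tnth x) p|)%:E | x in X])%E.

Definition tetrablock_contraction H (T : 3.-tuple (bop H H)) :=
  commuting T /\ spectral_set T tetrablock.

Definition tetrablock_unitary H (U : 3.-tuple (bop H H)) :=
  [/\ commuting U, forall i, normal_op (tnth U i) &
     taylor_spectrum U `<=` tetrablock_dist_boundary].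

(** Inclusions of Hilbert spaces are rendered by isometric embeddings: [A]
    lives on [H], [B] on [K], and [H], seen in [K] through [J], is invariant
    under every [B_i], with restriction [A_i]. *)
Definition is_extension H K n (A : n.-tuple (bop H H)) (B : n.-tuple (bop K K))
    (J : bop H K) :=
  isometric_op J /\ forall i x, tnth B i (J x) = J (tnth A i x).

Definition tetrablock_isometry K (V : 3.-tuple (bop K K)) :=
  commuting V /\
  exists (L : hilbertType R) (U : 3.-tuple (bop L L)) (J : bop K L),
    tetrablock_unitary U /\ is_extension V U J.

Definition has_tetrablock_isometric_lift H (T : 3.-tuple (bop H H)) :=
  exists (K : hilbertType R) (V : 3.-tuple (bop K K)) (J : bop H K),
    [/\ tetrablock_isometry V, isometric_op J &
       forall i h, adjoint (tnth V i) (J h) = J (adjoint (tnth T i) h)].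

(** [D] is the positive square root of [I - T^* T], which is unique. *)
Definition defect_operator H (T D : bop H H) :=
  positive_op D /\ forall h, D (D h) = h - adjoint T (T h).

Definition defect_space H (D : bop H H) : hilbertType R := csType (closure_range D).

Definition fundamental_operators H (T1 T2 T D : bop H H)
    (F1 F2 : bop (defect_space D) (defect_space D)) :=
  (forall h, T1 h - adjoint T2 (T h) = D (val (F1 (corestrict D h)))) /\
  (forall h, T2 h - adjoint T1 (T h) = D (val (F2 (corestrict D h)))).

End tetrablock.

(* Main.v *)
Require Import Defs.
From HB Require Import structures.
From mathcomp Require Import all_boot all_order all_algebra.
From mathcomp Require Import all_classical all_reals all_analysis.
From mathcomp Require Import complex.
From mathcomp Require Import cyclic separable cyclotomic ring lra.

Set Implicit Arguments.
Unset Strict Implicit.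
Unset Printing Implicit Defensive.

Import Order.TTheory GRing.Theory Num.Theory.
Import numFieldNormedType.Exports.
Local Open Scope classical_set_scope.
Local Open Scope ring_scope.
Local Open Scope complex_scope.


(** Parts (2) and (3) hold without the lift: if [D h = 0] then
    [T1 h = T2^* T h] and [T2 h = T1^* T h], and the adjoint of the defining
    relation, [D F1^* D = T1^* - T^* T2], gives [F2^* D T h = D T1 h],
    [F1^* D T h = D T2 h] and [F1^* D T1 h = F2^* D T2 h].

    For part (1), let [V] on [K] be the isometric lift. Its third entry is an
    isometry with [V1 = V2^* V] and [V2 = V1^* V]. The orthogonal complement of
    [H] in [K] is invariant under [V1, V2]; let [S1, S2] be the restrictions,
    and let [Lam] map [D h] to the component of [V h] orthogonal to [H]. Then
    [F_i = Lam^* S_i Lam], and the first two entries [U1, U2] of a unitary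
    extension of [V] are a normal extension of [S1, S2].

    The relations [U1 = U2^* U], [U^* U = 1], [|U2| <= 1] must be read off the
    Taylor spectrum of [U]. By Fuglede's theorem all operators in sight commute
    with the adjoints of each other, so if such a relation failed, then some joint
    approximate eigenvalue of [U] would violate it; and a joint approximate
    eigenvalue lies in the Taylor spectrum, since there the last map of the
    Koszul complex is not onto. Conversely the relations bound
    [|(U1 - z1) x| + |(U2 - z2) x|] from below unless [|z1| = |z2| <= 1], and
    such a bound splits the Koszul complex of the pair. *)

(** * Hilbert spaces and adjoints *)

Section Norm.
Variables (R : realType) (V : normedZmodType R[i]).
Implicit Types x y : V.

(* The norms live in [R[i]]; [nr] is the norm as a real number. *)
Definition nr x : R := complex.Re `|x|.

Lemma nrE x : `|x| = (nr x)%:C.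
Proof. by rewrite /nr RRe_real // normr_real. Qed.

Lemma nr_ge0 x : 0 <= nr x.
Proof. by rewrite -lecR -nrE normr_ge0. Qed.

Lemma nr0 : nr (0 : V) = 0.
Proof. by rewrite /nr normr0. Qed.

Lemma nr_eq0 x : nr x = 0 -> x = 0.
Proof. by move=> h; apply/eqP; rewrite -normr_eq0 nrE h. Qed.

Lemma nr_gt0 x : x != 0 -> 0 < nr x.
Proof.
by move=> x0; rewrite lt_neqAle nr_ge0 andbT; apply: contra_neq x0 => /esym/nr_eq0.
Qed.

Lemma nrN x : nr (- x) = nr x.
Proof. by rewrite /nr normrN. Qed.

Lemma nrD x y : nr (x + y) <= nr x + nr y.
Proof. by rewrite -lecR rmorphD /= -!nrE ler_normD. Qed.

Lemma nrB x y : nr (x - y) <= nr x + nr y.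
Proof. by rewrite -(nrN y) nrD. Qed.

Lemma nrC x y : nr (x - y) = nr (y - x).
Proof. by rewrite -nrN opprB. Qed.

Lemma nr_sub x y : nr x - nr y <= nr (x - y).
Proof. by rewrite lerBlDr -{1}(subrK y x) nrD. Qed.

Lemma nr_lt x (e : R) : (`|x| < e%:C) = (nr x < e).
Proof. by rewrite nrE ltcR. Qed.

End Norm.

Section Scalars.
Variable R : realType.
Implicit Types a b : R[i].

Lemma nrM a b : nr (a * b) = nr a * nr b.
Proof. by apply: complexI; rewrite rmorphM /= -!nrE normrM. Qed.

Lemma nr_real (t : R) : nr t%:C = `|t|.
Proof.
by rewrite /nr normc_def /= expr0n addr0 sqrtr_sqr.
Qed.

Lemma nrJ a : nr a^* = nr a.
Proof. by rewrite /nr normcJ. Qed.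

Lemma nr_i : nr ('i : R[i]) = 1.
Proof. by rewrite /nr normc_def /= expr0n expr1n add0r sqrtr1. Qed.

Lemma Re_le a : complex.Re a <= nr a.
Proof.
by rewrite (le_trans (ler_norm _)) // -lecR -nrE normc_ge_Re.
Qed.

Lemma nr_sqr a : nr a ^+ 2 = complex.Re (a * a^*).
Proof. by rewrite -sqr_normc nrE -rmorphXn. Qed.

Lemma ReD a b : complex.Re (a + b) = complex.Re a + complex.Re b.
Proof. by case: a b => ? ? [? ?]. Qed.

Lemma ReN a : complex.Re (- a) = - complex.Re a.
Proof. by case: a. Qed.

Lemma ReB a b : complex.Re (a - b) = complex.Re a - complex.Re b.
Proof. by rewrite ReD ReN. Qed.

Lemma Re_realM (t : R) a : complex.Re (t%:C * a) = t * complex.Re a.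
Proof. by case: a => u v /=; rewrite mul0r subr0. Qed.

Lemma ReJ a : complex.Re a^* = complex.Re a.
Proof. by case: a. Qed.

(** The second real part is minus the imaginary part. Equalities of complex inner products thus
    reduce to real ones, tested at [x] and at ['i x]. *)
Lemma complex_eq0 a :
  complex.Re a = 0 -> complex.Re ('i%C * a) = 0 -> a = 0.
Proof. by case: a => u v /= ->; rewrite mul0r mul1r sub0r => /eqP; rewrite oppr_eq0 => /eqP ->. Qed.

End Scalars.

Lemma nrZ (R : realType) (V : normedModType R[i]) (a : R[i]) (x : V) :
  nr (a *: x) = nr a * nr x.
Proof. by apply: complexI; rewrite rmorphM /= -!nrE normrZ. Qed.

Section Inner.
Variables (R : realType) (H : hilbertType R).
Implicit Types (x y z : H) (a : R[i]).

Lemma innerDl x y z : inner (x + y) z = inner x z + inner y z.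
Proof. exact: (linearDl (@inner R H) z x y). Qed.
Lemma innerDr x y z : inner x (y + z) = inner x y + inner x z.
Proof. exact: (linearDr (@inner R H) x y z). Qed.
Lemma innerNl x z : inner (- x) z = - inner x z.
Proof. exact: (linearNl (@inner R H) z x). Qed.
Lemma innerNr x z : inner x (- z) = - inner x z.
Proof. exact: (linearNr (@inner R H) x z). Qed.
Lemma innerBl x y z : inner (x - y) z = inner x z - inner y z.
Proof. exact: (linearBl (@inner R H) z x y). Qed.
Lemma innerBr x y z : inner x (y - z) = inner x y - inner x z.
Proof. exact: (linearBr (@inner R H) x y z). Qed.
Lemma innerZl a x z : inner (a *: x) z = a * inner x z.
Proof. exact: (linearZl_LR (@inner R H) z a x). Qed.
Lemma innerZr a x z : inner x (a *: z) = a^* * inner x z.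
Proof. exact: (linearZr_LR (@inner R H) x a z). Qed.
Lemma innerJr a x z : inner x (a^* *: z) = a * inner x z.
Proof. by rewrite innerZr; congr (_ * _); exact: conjcK. Qed.
Lemma innerIr x z : inner x ('i%C *: z) = - ('i%C * inner x z).
Proof.
rewrite innerZr -mulNr; congr (_ * _).
by apply/eqP; rewrite eq_complex /= oppr0 !eqxx.
Qed.
Lemma inner0l z : inner (0 : H) z = 0.
Proof. exact: (linear0l (@inner R H) z). Qed.
Lemma inner0r z : inner z (0 : H) = 0.
Proof. exact: (linear0r (@inner R H) z). Qed.
Lemma innerC x y : inner x y = (inner y x)^*.
Proof. by have := hermC (@inner R H) x y; rewrite expr0 mul1r. Qed.

Lemma inner_nr x : inner x x = (nr x ^+ 2)%:C.
Proof. by rewrite inner_norm nrE -rmorphXn. Qed.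

Definition rip x y : R := complex.Re (inner x y).

Lemma ripC x y : rip x y = rip y x.
Proof. by rewrite /rip innerC ReJ. Qed.

Lemma ripDl x y z : rip (x + y) z = rip x z + rip y z.
Proof. by rewrite /rip innerDl ReD. Qed.
Lemma ripDr x y z : rip x (y + z) = rip x y + rip x z.
Proof. by rewrite /rip innerDr ReD. Qed.
Lemma ripNl x z : rip (- x) z = - rip x z.
Proof. by rewrite /rip innerNl ReN. Qed.
Lemma ripNr x z : rip x (- z) = - rip x z.
Proof. by rewrite /rip innerNr ReN. Qed.
Lemma ripZl (t : R) x z : rip (t%:C *: x) z = t * rip x z.
Proof. by rewrite /rip innerZl Re_realM. Qed.
Lemma ripZr (t : R) x z : rip x (t%:C *: z) = t * rip x z.
Proof. by rewrite ripC ripZl ripC. Qed.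
Definition ripE := (ripDl, ripDr, ripNl, ripNr, ripZl, ripZr).

Lemma rip_nr x : rip x x = nr x ^+ 2.
Proof. by rewrite /rip inner_nr. Qed.

Lemma cauchy_schwarz_rip x y : rip x y <= nr x * nr y.
Proof.
have [->|y0] := eqVneq y 0; first by rewrite /rip inner0r nr0 mulr0.
have ny := nr_gt0 y0; have nx := nr_ge0 x.
(* Expanding this square gives [2 |x| |y| (|x| |y| - rip x y) >= 0]. *)
have := sqr_ge0 (nr ((nr y)%:C *: x - (nr x)%:C *: y)).
rewrite -rip_nr !ripE !rip_nr (ripC y x) => h.
have [x0|x0] := eqVneq x 0; first by rewrite x0 /rip inner0l nr0 mul0r.
have nx' := nr_gt0 x0.
have : 0 <= (nr x * nr y) * (nr x * nr y - rip x y) by nra.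
by rewrite pmulr_rge0 ?subr_ge0 // mulr_gt0.
Qed.

Lemma cauchy_schwarz x y : nr (inner x y) <= nr x * nr y.
Proof.
have [->|a0] := eqVneq (inner x y) 0; first by rewrite nr0 mulr_ge0 ?nr_ge0.
have na := nr_gt0 a0.
(* Multiplying [x] by the conjugate of [inner x y] turns the pairing into the real number
   [|inner x y| ^ 2]. *)
have := cauchy_schwarz_rip ((inner x y)^* *: x) y.
rewrite /rip innerZl mulrC -nr_sqr nrZ nrJ expr2 -mulrA.
by rewrite ler_pM2l.
Qed.

Lemma nr_sqrD x y : nr (x + y) ^+ 2 = nr x ^+ 2 + 2 * rip x y + nr y ^+ 2.
Proof. by rewrite -!rip_nr !ripE (ripC y x); ring. Qed.

Lemma inner_ext x y : (forall z, inner z x = inner z y) -> x = y.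
Proof.
move=> h; apply/eqP; rewrite -subr_eq0; apply/eqP/nr_eq0/eqP.
by rewrite -sqrf_eq0 -rip_nr /rip innerBr h subrr.
Qed.

End Inner.

Section Bounded.
Variable R : realType.

Definition nbounded (V W : normedModType R[i]) (f : V -> W) (M : R) :=
  forall x, nr (f x) <= M * nr x.

Lemma nbounded_continuous (V W : normedModType R[i]) (f : {linear V -> W}) (M : R) :
  nbounded f M -> continuous f.
Proof.
move=> h; apply: bounded_linear_continuous; apply/linear_boundedP.
exists (M%:C); split; first by apply/complex_realP; exists M.
move=> r Mr x; apply: (@le_trans _ _ (M%:C * `|x|)).
  by rewrite !nrE -rmorphM lecR.
by apply: ler_wpM2r => //; apply: ltW.
Qed.

Lemma continuous_nbounded (V W : normedModType R[i]) (f : {linear V -> W}) :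
  continuous f -> exists2 M, 0 < M & nbounded f M.
Proof.
move=> /linear_bounded_continuous /linear_boundedP /pinfty_ex_gt0[r r0 h].
have rr : r \is Num.real by rewrite gtr0_real.
exists (complex.Re r); first by move: r0; rewrite -{1}(RRe_real rr) ltcR.
by move=> x; rewrite -lecR rmorphM /= -!nrE (RRe_real rr).
Qed.

Lemma bop_bounded (H K : hilbertType R) (A : bop H K) :
  exists2 M, 0 < M & nbounded A M.
Proof. exact/continuous_nbounded/bop_continuous. Qed.

Definition bop_of (H K : hilbertType R) (f : {linear H -> K}) (M : R)
  (h : nbounded f M) : bop H K := Bop (nbounded_continuous h).

(** The sets [B d] form a base of a Cauchy filter as [d] tends to 0, so completeness gives its
    limit. Indexing by [d] avoids choosing minimizing or approximating sequences. *)
Lemma cantor_complete (H : hilbertType R) (B : R -> set H) :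
  (forall d, 0 < d -> B d !=set0) ->
  (forall d d', d <= d' -> B d `<=` B d') ->
  (forall e, 0 < e -> exists2 d, 0 < d & forall x y, B d x -> B d y -> nr (x - y) < e) ->
  exists l, forall e, 0 < e -> exists2 d, 0 < d & forall x, B d x -> nr (l - x) < e.
Proof.
move=> B0 Bmono Bdiam.
pose F : set_system H := filter_from [set d : R | 0 < d] B.
have FF : ProperFilter F.
  apply: filter_from_proper; last by move=> d; apply: B0.
  apply: filter_from_filter; first by exists 1 => /=.
  move=> d d' /= d0 d'0; exists (Order.min d d'); first by rewrite /= lt_min d0.
  by move=> x Bx; split; apply: Bmono Bx; rewrite ge_min lexx ?orbT.
have /cvg_ex[l Fl] : cvg F.
  apply: cauchy_cvg; apply/cauchy_exP => e e0.
  have er : e \is Num.real by rewrite gtr0_real.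
  have re0 : 0 < complex.Re e by rewrite -ltcR RRe_real.
  have [d d0 h] := Bdiam _ re0; have [x Bx] := B0 _ d0.
  exists x; rewrite /fmap /=; exists d => // y By.
  by rewrite -ball_normE /ball_ /= -(RRe_real er) nr_lt; apply: h.
exists l => e e0; have e0' : 0 < e%:C by rewrite ltcR.
have /cvgrPdist_lt/(_ _ e0')[d /= d0 h] : id x @[x --> F] --> l := Fl.
exists d => // x /h /=.
by rewrite nr_lt.
Qed.

End Bounded.

(** * Minimization of quadratic functionals and the Lax-Milgram theorem *)

Section LaxMilgram.
Variables (R : realType) (H : hilbertType R).
Variables (P : {linear H -> H}) (phi : H -> R[i]) (c M b : R).
Hypotheses (c0 : 0 < c) (Pb : nbounded P M).
Hypothesis Psym : forall x y, inner (P x) y = inner x (P y).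
Hypothesis Pc : forall x, c * nr x ^+ 2 <= rip (P x) x.
Hypothesis phiD : forall x y, phi (x + y) = phi x + phi y.
Hypothesis phiZ : forall a x, phi (a *: x) = a * phi x.
Hypothesis phib : forall x, nr (phi x) <= b * nr x.

Let E x := rip (P x) x - 2 * complex.Re (phi x).

(** Complete the square: [c t^2 - 2 b t >= - b^2 / c] for [t = nr x]. *)
Let E_ge x : - (b ^+ 2 / c) <= E x.
Proof.
have nx := nr_ge0 x.
have h1 := Pc x; have h2 := le_trans (Re_le _) (phib x).
have h3 : 0 <= (c * nr x - b) ^+ 2 / c by rewrite divr_ge0 ?sqr_ge0 ?ltW.
have h4 : (c * nr x - b) ^+ 2 / c = c * nr x ^+ 2 - 2 * (b * nr x) + b ^+ 2 / c.
  by field; rewrite gt_eqF.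
rewrite /E; lra.
Qed.

Let E_line x h (t : R) : E (x + t%:C *: h) =
  E x + 2 * t * (rip (P x) h - complex.Re (phi h)) + t ^+ 2 * rip (P h) h.
Proof.
rewrite /E linearD linearZ /= !ripE phiD phiZ ReD Re_realM.
have -> : rip (P h) x = rip (P x) h by rewrite {1}/rip Psym -/(rip _ _) ripC.
ring.
Qed.

Let m := inf (range E).

Let has_infE : has_inf (range E).
Proof.
split; first by exists (E 0); exists 0.
by exists (- (b ^+ 2 / c)) => _ [x _ <-]; apply: E_ge.
Qed.

Let m_le x : m <= E x.
Proof. by apply: ge_inf; [exact: has_infE.2|exists x]. Qed.

(** The solution is the minimizer of the energy [E]: coercivity makes near-minimizers close to each
    other, and the first-order condition at the minimum is the equation. With [P] the identity this
    is the Riesz theorem; later it inverts the Koszul Laplacian of a pair. *)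
Lemma lax_milgram : exists x, forall h, inner h (P x) = phi h.
Proof.
have [l hl] : exists l, forall e, 0 < e ->
    exists2 d, 0 < d & forall x, E x < m + d -> nr (l - x) < e.
  apply: (@cantor_complete _ H (fun d => [set x | E x < m + d])).
  - move=> d d0; have [_ [x _ <-] h] := inf_adherent d0 has_infE.
    by exists x.
  - by move=> d d' dd x /= h; apply: lt_le_trans h _; rewrite lerD2l.
  (* Parallelogram identity: the mean of [E x] and [E y] exceeds the value of [E] at the midpoint by
     [rip (P (x - y)) (x - y) / 4], which is at least [c |x - y|^2 / 4]. *)
  - move=> e e0; exists (c * e ^+ 2 / 4) => [|x y /= Ex Ey].
      by rewrite divr_gt0 // mulr_gt0 // exprn_gt0.
    have m1 := E_line y (x - y) 1; have m2 := E_line y (x - y) (1/2).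
    have m3 := m_le (y + (1/2 : R)%:C *: (x - y)).
    rewrite (scale1r (x - y)) (addrC y) subrK in m1.
    have := Pc (x - y) => m4.
    have : c * (nr (x - y) ^+ 2) < c * e ^+ 2 by lra.
    rewrite ltr_pM2l // => m5.
    by rewrite -(@ltr_pXn2r _ 2) ?nnegrE ?nr_ge0 ?ltW.
(* The limit attains the infimum. In the expansion of [E] around [l] the quadratic term is
   nonnegative and the linear one is at least [- K * nr (x - l)]. Absolute values are taken because
   the bounds [M] and [b] carry no sign. *)
have El : forall d, 0 < d -> E l <= m + d.
  move=> d d0.
  pose K := 2 * (`|M| * nr l + `|b|) + `|M|.
  have K0 : 0 <= K by rewrite addr_ge0 // mulr_ge0 // addr_ge0 // mulr_ge0 // nr_ge0.
  pose e := Order.min 1 (d / 2 / (K + 1)).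
  have e0 : 0 < e by rewrite lt_min ltr01 !divr_gt0 // ltr_wpDl.
  have [d1 d10 h1] := hl _ e0.
  pose d2 := Order.min d1 (d / 2).
  have d20 : 0 < d2 by rewrite lt_min d10 divr_gt0.
  have [_ [x _ <-] h2] := inf_adherent d20 has_infE.
  have h3 : nr (l - x) < e.
    by apply: h1; apply: lt_le_trans h2 _; rewrite lerD2l ge_min lexx.
  have h4 : E x < m + d / 2.
    by apply: lt_le_trans h2 _; rewrite lerD2l ge_min lexx orbT.
  have p6 := E_line l (x - l) 1.
  rewrite (scale1r (x - l)) (addrC l) subrK in p6; rewrite nrC in h3.
  have p1 : - (`|M| * nr l * nr (x - l)) <= rip (P l) (x - l).
    rewrite lerNl -ripNl -linearN; apply: le_trans (cauchy_schwarz_rip _ _) _.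
    apply: ler_wpM2r; first exact: nr_ge0.
    apply: le_trans (Pb _) _; rewrite nrN.
    by apply: ler_wpM2r; [exact: nr_ge0|exact: ler_norm].
  have p2 : complex.Re (phi (x - l)) <= `|b| * nr (x - l).
    apply: le_trans (Re_le _) _; apply: le_trans (phib _) _.
    by apply: ler_wpM2r; [exact: nr_ge0|exact: ler_norm].
  have p3 : 0 <= rip (P (x - l)) (x - l).
    by apply: le_trans (Pc _); rewrite mulr_ge0 ?sqr_ge0 ?ltW.
  have p4 : nr (x - l) <= d / 2 / (K + 1).
    by apply: ltW; apply: lt_le_trans h3 _; rewrite ge_min lexx orbT.
  have p5 : K * nr (x - l) <= d / 2.
    have /(ler_wpM2l K0) /le_trans -> // := p4.
    rewrite mulrCA -[leRHS]mulr1 ler_wpM2l ?divr_ge0 ?ltW //.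
    by rewrite ltr_pdivrMr ?mul1r ?ltrDl // ltr_wpDl.
  rewrite expr1n in p6.
  have p7 : 2 * (`|M| * nr l + `|b|) * nr (x - l) <= K * nr (x - l).
    by rewrite ler_wpM2r ?nr_ge0 // lerDl.
  lra.
have mE : E l = m.
  apply/eqP; rewrite eq_le m_le andbT; apply/ler_addgt0Pr => d d0.
  exact: El.
exists l => h.
have var h' : rip (P l) h' = complex.Re (phi h').
  apply/eqP; rewrite -subr_eq0; apply/negPn/negP.
  set g := _ - _ => g0.
  have M0 : 0 <= rip (P h') h'.
    by apply: le_trans (Pc _); rewrite mulr_ge0 ?sqr_ge0 ?ltW.
  set q := rip (P h') h' in M0.
  have q1 : 0 < q + 1 by lra.
  (* A step of length [- g / q] would be optimal along [h']; the [+ 1] guards against [q = 0] and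
     still decreases [E] strictly. *)
  have := m_le (l + (- g / (q + 1))%:C *: h').
  rewrite E_line mE -/q -/g => u.
  have : m + 2 * (- g / (q + 1)) * g + (- g / (q + 1)) ^+ 2 * q =
      m - (g ^+ 2 * (q + 2)) / (q + 1) ^+ 2 by field; rewrite gt_eqF.
  have : 0 < (g ^+ 2 * (q + 2)) / (q + 1) ^+ 2.
    rewrite divr_gt0 ?exprn_gt0 // mulr_gt0 //; last lra.
    by rewrite lt_neqAle sqr_ge0 eq_sym sqrf_eq0 g0.
  lra.
(* [var] settles the real parts; applied to ['i h] it settles the imaginary parts. *)
apply/eqP; rewrite -subr_eq0; apply/eqP/complex_eq0.
  by rewrite ReB -/(rip _ _) ripC var subrr.
by rewrite mulrBr -innerZl -phiZ ReB -/(rip _ _) ripC var subrr.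
Qed.

End LaxMilgram.

Section Adjoint.
Variable R : realType.

Lemma riesz (H : hilbertType R) (phi : H -> R[i]) (b : R) :
  (forall x y, phi (x + y) = phi x + phi y) ->
  (forall a x, phi (a *: x) = a * phi x) ->
  (forall x, nr (phi x) <= b * nr x) -> exists x, forall h, phi h = inner h x.
Proof.
move=> h1 h2 h3.
have i1 : nbounded (idfun : H -> H) 1 by move=> x; rewrite mul1r.
have i2 (x : H) : 1 * nr x ^+ 2 <= rip (idfun x) x by rewrite mul1r rip_nr.
have [x hx] := lax_milgram ltr01 i1 (fun _ _ => erefl) i2 h1 h2 h3.
by exists x.
Qed.

(** The Riesz theorem supplies the vector that [get] selects in [adjoint]. *)
Lemma adjointP (H K : hilbertType R) (A : bop H K) x y :
  inner (A x) y = inner x (adjoint A y).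
Proof.
have [M M0 hM] := bop_bounded A.
have [|||z hz] := @riesz H (fun h => inner (A h) y) (M * nr y).
- by move=> u v; rewrite linearD innerDl.
- by move=> a u; rewrite linearZ innerZl.
- move=> u; apply: le_trans (cauchy_schwarz _ _) _.
  by rewrite mulrAC ler_wpM2r ?nr_ge0.
- move: x; rewrite /adjoint; apply: (@getPex _ [set x | forall h, inner (A h) y = inner h x]).
  by exists z.
Qed.

Lemma adjointPr (H K : hilbertType R) (A : bop H K) x y :
  inner y (A x) = inner (adjoint A y) x.
Proof. by rewrite innerC adjointP -innerC. Qed.

Lemma adjoint_uniq (H K : hilbertType R) (A : bop H K) y z :
  (forall x, inner (A x) y = inner x z) -> adjoint A y = z.
Proof. by move=> h; apply: inner_ext => x; rewrite -adjointP h. Qed.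

Section AdjointBop.
Variables (H K : hilbertType R) (A : bop H K).

Fact adjoint_linear : linear (adjoint A).
Proof.
by move=> a x y; apply: inner_ext => z; rewrite -adjointP !innerDr !innerZr -!adjointP.
Qed.
HB.instance Definition _ := GRing.isLinear.Build _ _ _ _ (adjoint A) adjoint_linear.

(** Divide [|A^* y|^2 = <A A^* y, y> <= M |A^* y| |y|] by [|A^* y|]. *)
Lemma adjoint_nbounded M : 0 <= M -> nbounded A M -> nbounded (adjoint A) M.
Proof.
move=> M0 h y; have [->|y0] := eqVneq (adjoint A y) 0.
  by rewrite nr0 mulr_ge0 ?nr_ge0.
rewrite -(ler_pM2l (nr_gt0 y0)) -expr2 -rip_nr /rip -adjointP.
apply: le_trans (cauchy_schwarz_rip _ _) _; rewrite mulrCA mulrA.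
by rewrite ler_wpM2r ?nr_ge0.
Qed.

Lemma adjoint_continuous : continuous (adjoint A).
Proof.
have [M M0 hM] := bop_bounded A.
exact/nbounded_continuous/(adjoint_nbounded (ltW M0) hM).
Qed.

Definition adj : bop K H := Bop adjoint_continuous.

End AdjointBop.

Lemma adjointK (H K : hilbertType R) (A : bop H K) x :
  adjoint (adj A) x = A x.
Proof. by apply: adjoint_uniq => y /=; rewrite -adjointPr. Qed.

End Adjoint.

(** * Fuglede's theorem *)

Section RootsOfUnity.
Variable R : realType.

(** [X^n - 1] splits over the algebraically closed field [R[i]] and is separable in characteristic
    0, so it has [n] distinct roots, and a field with [n] roots of unity of order dividing [n] has a
    primitive one. *)
Lemma complex_prim_root_exists n : (0 < n)%N -> exists z : R[i], n.-primitive_root z.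
Proof.
pose p : {poly R[i]} := 'X^n - 1; have [r Dp] := closed_field_poly_normal p.
move=> n_gt0; rewrite (monicP _) ?monicXnsubC // scale1r in Dp.
have rn1 : all n.-unity_root r.
  by apply/allP=> z; rewrite -root_prod_XsubC -Dp.
have sz_r : (n < (size r).+1)%N.
  by rewrite -(size_prod_XsubC r id) -Dp size_XnsubC.
have [|z] := hasP (has_prim_root n_gt0 rn1 _ sz_r); last by exists z.
by rewrite -separable_prod_XsubC -Dp separable_Xn_sub_1 // pnatr_eq0 -lt0n.
Qed.

(** Orthogonality of characters of a cyclic group, by the geometric sum. *)
Lemma sum_prim_root (z : R[i]) m k : m.-primitive_root z ->
  \sum_(j < m) z ^+ (j * k) = if (m %| k)%N then m%:R else 0.
Proof.
move=> zm; case: ifPn => mk.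
  rewrite (eq_bigr (fun=> 1)) ?sumr_const ?card_ord // => j _.
  by apply/eqP; rewrite -(prim_order_dvd zm) dvdn_mull.
have zk : z ^+ k - 1 != 0 by rewrite subr_eq0 -(prim_order_dvd zm).
apply: (mulfI zk); rewrite mulr0 (eq_bigr (fun j : 'I_m => (z ^+ k) ^+ j)).
  by rewrite -subrX1 -exprM mulnC exprM (prim_expr_order zm) expr1n subrr.
by move=> j _; rewrite -exprM mulnC.
Qed.

Lemma nrX (z : R[i]) k : nr (z ^+ k) = nr z ^+ k.
Proof.
elim: k => [|k IH]; first by rewrite !expr0 /nr normr1.
by rewrite !exprS nrM IH.
Qed.

Lemma nr_prim_root (z : R[i]) m : m.-primitive_root z -> nr z = 1.
Proof.
move=> zm; have m0 := prim_order_gt0 zm.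
apply/eqP; rewrite -(@pexpr_eq1 _ _ m) ?nr_ge0 //; apply/eqP.
by rewrite -nrX (prim_expr_order zm) /nr normr1.
Qed.

Lemma nr_sum (V : normedModType R[i]) (I : Type) (s : seq I) (F : I -> V) :
  nr (\sum_(i <- s) F i) <= \sum_(i <- s) nr (F i).
Proof.
elim/big_ind2 : _ => //; first by rewrite nr0.
by move=> x a y b h1 h2; apply: le_trans (nrD _ _) (lerD h1 h2).
Qed.

Lemma nr_nat n : nr (n%:R : R[i]) = n%:R.
Proof. by rewrite -(rmorph_nat (real_complex R)) nr_real ger0_norm. Qed.

(** Averaging over roots of unity against [z ^+ (j * d.-1)], the inverse of [z ^+ j], therefore
    isolates the coefficient of index 1. *)
Lemma dvdn_pred_add d k : (1 < d)%N -> (k < d)%N -> (d %| d.-1 + k)%N -> k = 1%N.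
Proof.
case: d => // d d0 kd /= /dvdnP[[|[|q]] hq]; rewrite ?mul0n ?mul1n in hq.
- by move/eqP: hq d0; rewrite addn_eq0 => /andP[/eqP ->].
- by apply/eqP; rewrite -(eqn_add2l d) hq addn1.
- have : (d.+1 + d.+1 <= d + k)%N by rewrite hq !mulSn addnA leq_addr.
  by rewrite leqNgt -addSn leq_add // ltnW.
Qed.

(** Cauchy's estimate for the linear coefficient, with the contour integral replaced by the mean
    over the [d] points [r z^j]. The mean is exact because the degree is less than [d]. *)
Lemma cauchy_estimate (V : normedModType R[i]) (c : nat -> V) d (r B : R) :
  (1 < d)%N -> 0 < r ->
  (forall l : R[i], nr l = r -> nr (\sum_(k < d) l ^+ k *: c k) <= B) ->
  r * nr (c 1%N) <= B.
Proof.
move=> d1 r0 h; have d0 : (0 < d)%N by apply: ltnW.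
have [z zd] := complex_prim_root_exists d0.
have nz := nr_prim_root zd.
have : \sum_(j < d) z ^+ (j * d.-1) *: (\sum_(k < d) (r%:C * z ^+ j) ^+ k *: c k)
    = (d%:R * r%:C) *: c 1%N.
  under eq_bigr do rewrite scaler_sumr.
  rewrite exchange_big /= (bigD1 (Ordinal d1)) //= [X in _ + X]big1 => [|k k1].
    rewrite addr0; under eq_bigr do rewrite scalerA.
    rewrite -scaler_suml; congr (_ *: _).
    rewrite (eq_bigr (fun j : 'I_d => z ^+ (j * d) * r%:C)); last first.
      move=> j _; rewrite expr1 mulrCA mulrC -exprD; congr (_ ^+ _ * _).
      by rewrite -mulnSr prednK.
    by rewrite -mulr_suml (sum_prim_root _ zd) dvdnn.
  under eq_bigr do rewrite scalerA.
  rewrite -scaler_suml (eq_bigr (fun j : 'I_d => z ^+ (j * (d.-1 + k)) * r%:C ^+ k)).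
    rewrite -mulr_suml (sum_prim_root _ zd) ifN ?mul0r ?scale0r //.
    by apply: contra k1 => /(dvdn_pred_add d1 (ltn_ord k)) k1; apply/eqP/val_inj.
  by move=> j _; rewrite exprMn mulrCA mulrC -exprM -exprD mulnDr.
move=> e.
have : nr ((d%:R * r%:C) *: c 1%N) <= \sum_(j < d) B.
  rewrite -e; apply: le_trans (nr_sum _ _) _; apply: ler_sum => j _.
  rewrite nrZ nrX nz expr1n mul1r; apply: h.
  by rewrite nrM nrX nz expr1n mulr1 nr_real gtr0_norm.
rewrite nrZ nrM nr_real gtr0_norm // sumr_const card_ord.
rewrite nr_nat -(mulr_natl B) -mulrA.
by rewrite ler_pM2l // ltr0n.
Qed.

End RootsOfUnity.

Section PolynomialCurves.
Variables (R : realType) (V W : normedModType R[i]).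

(** A vector-valued polynomial in [l] of which only the first two coefficients are remembered;
    [1 < d] ensures that [c 1] occurs in the sum. *)
Definition pcurve (U : normedModType R[i]) (g : R[i] -> U) (c0 c1 : U) :=
  exists d (c : nat -> U), [/\ (1 < d)%N, c 0 = c0, c 1%N = c1 &
    forall l, g l = \sum_(k < d) l ^+ k *: c k].

Lemma pcurve_cst (x : V) : pcurve (fun=> x) x 0.
Proof.
exists 2, (fun k => if k is 0 then x else 0); split=> // l.
by rewrite !big_ord_recl big_ord0 /= expr0 scale1r scaler0 !addr0.
Qed.

Lemma pcurve_linear (T : {linear V -> W}) g c0 c1 :
  pcurve g c0 c1 -> pcurve (T \o g) (T c0) (T c1).
Proof.
move=> [d [c [d1 <- <- h]]]; exists d, (T \o c); split=> // l /=.
by rewrite h linear_sum; apply: eq_bigr => k _; rewrite linearZ.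
Qed.

Lemma pcurve_step (T : {linear V -> V}) g c0 c1 :
  pcurve g c0 c1 -> pcurve (fun l => g l + l *: T (g l)) c0 (c1 + T c0).
Proof.
move=> [d [c [d1 <- <- h]]].
exists d.+1, (fun k => (if (k < d)%N then c k else 0) + (if k is k'.+1 then T (c k') else 0)).
split; rewrite ?d1 ?(ltnW d1) ?addr0 //; first exact: ltnW.
move=> l; under eq_bigr do rewrite scalerDr.
rewrite big_split /= big_ord_recr /= ltnn scaler0 addr0 big_ord_recl /= scaler0 add0r.
congr (_ + _); first by rewrite h; apply: eq_bigr => k _; rewrite ltn_ord.
rewrite h linear_sum scaler_sumr; apply: eq_bigr => k _.
by rewrite linearZ scalerA exprS.
Qed.

Lemma pcurve_iter (T : {linear V -> V}) n g c0 c1 : pcurve g c0 c1 ->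
  pcurve (fun l => iter n (fun x => x + l *: T x) (g l)) c0 (c1 + n%:R *: T c0).
Proof.
move=> h; elim: n => [|n IH] /=; first by rewrite scale0r addr0.
by rewrite -natr1 scalerDl scale1r addrA; apply: (pcurve_step T IH).
Qed.

End PolynomialCurves.

Section Iterates.
Variables (R : realType) (V : normedModType R[i]).
Implicit Types f g : V -> V.

Lemma iter_commute f g n : (forall x, f (g x) = g (f x)) ->
  forall x, iter n f (g x) = g (iter n f x).
Proof. by move=> h x; elim: n => //= n ->. Qed.

Lemma iter_comp f g n : (forall x, f (g x) = g (f x)) ->
  forall x, iter n f (iter n g x) = iter n (fun x => f (g x)) x.
Proof.
move=> h x; elim: n => //= n <-.
by rewrite (iter_commute _ h).
Qed.

Lemma iter_nbounded f (K : R) n : 0 <= K -> nbounded f K -> nbounded (iter n f) (K ^+ n).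
Proof.
move=> K0 h x; elim: n => [|n IH] /=; first by rewrite mul1r.
apply: le_trans (h _) _; rewrite exprS -mulrA.
by rewrite ler_wpM2l.
Qed.

Lemma iter_near_id f (e : R) n : 0 <= e -> (forall x, nr (f x - x) <= e * nr x) ->
  forall x, nr (iter n f x - x) <= ((1 + e) ^+ n - 1) * nr x.
Proof.
move=> e0 h x.
have fb : nbounded f (1 + e).
  move=> y; rewrite -(subrK y (f y)); apply: le_trans (nrD _ _) _.
  by rewrite mulrDl mul1r [leRHS]addrC lerD2r; exact: h.
have e1 : 0 <= 1 + e by rewrite addr_ge0.
elim: n => [|n IH] /=; first by rewrite subrr nr0 expr0 subrr mul0r.
rewrite -(subrK (iter n f x) (f _)) -addrA; apply: le_trans (nrD _ _) _.
have := h (iter n f x).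
have := ler_wpM2l e0 (iter_nbounded n e1 fb x).
rewrite exprS; lra.
Qed.

End Iterates.

(** As [n] grows, [n s^2] tends to 0 while [(1 + s) ^ n] stays below [expR a], so the left side
    tends to 1; the bound 2 leaves room. *)
Lemma fuglede_estimate (R : realType) (a : R) : 0 <= a -> exists2 n, (0 < n)%N &
  let s := a / n%:R in
  (1 + 5 * s ^+ 2) ^+ n * (1 + 5 * s ^+ 2) ^+ n +
  (1 + s) ^+ n * ((1 + s ^+ 2) ^+ n - 1) * (1 + s) ^+ n <= 2.
Proof.
move=> a0; set L := expR a.
have L0 : 0 < L by apply: expR_gt0.
(* Chosen so that [u = 10 a^2 / n] below, which is [10 n s^2], satisfies [2 u (1 + L^2) <= 1]. The
   two summands are at most [1 + 2 u] and [2 u L^2]. *)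
pose n := (Num.truncn (20 * a ^+ 2 * (1 + L ^+ 2))).+1.
have n0 : 0 < n%:R :> R by rewrite ltr0n.
have n1 : 20 * a ^+ 2 * (1 + L ^+ 2) <= n%:R.
  exact/ltW/truncnS_gt.
exists n => //=; set s := a / n%:R.
have s0 : 0 <= s by rewrite divr_ge0 // ltW.
have expX (y : R) : 0 <= y -> (1 + y) ^+ n <= expR (n%:R * y).
  move=> y0; rewrite expRM_natl lerXn2r ?nnegrE ?expR_ge0 //.
    by rewrite addr_ge0.
  exact: expR_ge1Dx.
set u := 10 * a ^+ 2 / n%:R.
have u0 : 0 <= u by apply: divr_ge0; [rewrite mulr_ge0 // sqr_ge0|exact: ltW].
have u1 : 2 * u * (1 + L ^+ 2) <= 1.
  have -> : 2 * u * (1 + L ^+ 2) = 20 * a ^+ 2 * (1 + L ^+ 2) / n%:R.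
    by rewrite /u; field; rewrite gt_eqF.
  by rewrite ler_pdivrMr // mul1r.
have L2 : 0 < L ^+ 2 by rewrite exprn_gt0.
have u2 : u <= 1 / 2 by nra.
have u3 : expR u <= 1 + 2 * u.
  have e1 : 1 - u <= expR (- u) by apply: expR_ge1Dx.
  have e2 : expR u * expR (- u) = 1 by rewrite -expRD subrr expR0.
  have e3 := expR_gt0 u.
  have : expR u * (1 - u) <= expR u * expR (- u) by rewrite ler_pM2l.
  rewrite e2.
  nra.
have h1 : (1 + s) ^+ n <= L.
  apply: le_trans (expX _ s0) _; rewrite /s mulrC divfK ?lexx // gt_eqF //.
have ns : n%:R * s ^+ 2 = u / 10 by rewrite /s /u; field; rewrite gt_eqF.
have h2 : (1 + s ^+ 2) ^+ n <= 1 + 2 * u.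
  apply: le_trans (expX _ (sqr_ge0 _)) _; rewrite ns; apply: le_trans u3.
  by rewrite ler_expR; lra.
have h3 : (1 + 5 * s ^+ 2) ^+ n * (1 + 5 * s ^+ 2) ^+ n <= 1 + 2 * u.
  have h5 : 0 <= 5 * s ^+ 2 by rewrite mulr_ge0 ?sqr_ge0.
  rewrite -expr2; apply: le_trans u3.
  apply: le_trans (_ : expR (n%:R * (5 * s ^+ 2)) ^+ 2 <= _).
    rewrite lerXn2r ?nnegrE ?expR_ge0 ?exprn_ge0 ?addr_ge0 //; exact: expX.
  by rewrite -expRM_natl ler_expR [n%:R * _]mulrCA ns; lra.
have h4 : 0 <= (1 + s) ^+ n by rewrite exprn_ge0 ?addr_ge0.
have h6 : 1 <= (1 + s ^+ 2) ^+ n by rewrite exprn_ege1 // lerDl sqr_ge0.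
have h7 : (1 + s) ^+ n * (1 + s) ^+ n <= L ^+ 2 by rewrite expr2 ler_pM.
have h8 : (1 + s) ^+ n * ((1 + s ^+ 2) ^+ n - 1) * (1 + s) ^+ n <= L ^+ 2 * (2 * u).
  by rewrite mulrAC ler_pM ?mulr_ge0 //; lra.
lra.
Qed.

Section Fuglede.
Variables (R : realType) (H : hilbertType R).
Variables (N Ns B : {linear H -> H}) (nu beta : R).
Hypothesis Nadj : forall x y, inner (N x) y = inner x (Ns y).
Hypothesis Nnorm : forall x, N (Ns x) = Ns (N x).
Hypothesis NB : forall x, N (B x) = B (N x).
Hypotheses (nu0 : 0 <= nu) (beta0 : 0 <= beta).
Hypotheses (Nb : nbounded N nu) (Bb : nbounded B beta).

(** The operator [1 + l A], whose [n]-th power at [l / n] stands in for [exp (l A)]. *)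
Let sh (l : R[i]) (A : {linear H -> H}) (x : H) := x + l *: A x.

Let linD (A : {linear H -> H}) l u v : A (u + l *: v) = A u + l *: A v.
Proof. by rewrite linearD linearZ. Qed.

Let shC l l' (A A' : {linear H -> H}) : (forall x, A (A' x) = A' (A x)) ->
  forall x, sh l A (sh l' A' x) = sh l' A' (sh l A x).
Proof.
move=> h x; rewrite /sh !linD /= h !scalerA (mulrC l').
by rewrite -!addrA; congr (_ + _); rewrite addrCA.
Qed.

Let nrNs x : nr (Ns x) = nr (N x).
Proof.
apply/eqP; rewrite -(@eqrXn2 _ 2) ?nr_ge0 //; apply/eqP.
by rewrite -!rip_nr /rip Nadj -Nnorm -[RHS]ReJ -innerC Nadj.
Qed.

Let Nsb : nbounded Ns nu.
Proof. by move=> x; rewrite nrNs. Qed.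

Let shb l (A : {linear H -> H}) : nbounded A nu -> nbounded (sh l A) (1 + nr l * nu).
Proof.
move=> h x; apply: le_trans (nrD _ _) _; rewrite nrZ mulrDl mul1r lerD2l -mulrA.
by rewrite ler_wpM2l ?nr_ge0.
Qed.

(* [l Ns - l^* N] is skew-adjoint, so the first-order term of the product does
   not contribute to the norm. *)
Let sh_skew l : nbounded (fun x => sh l Ns (sh (- l^*) N x)) (1 + 5 * (nr l * nu) ^+ 2).
Proof.
move=> x; set s := nr l * nu.
have s0 : 0 <= s by rewrite mulr_ge0 ?nr_ge0.
set k := l *: Ns x - l^* *: N x.
have -> : sh l Ns (sh (- l^*) N x) = (x + k) - (l * l^*) *: Ns (N x).
  rewrite /sh /k !linD /= scalerA mulNr !scaleNr (mulrC l) -!addrA.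
  by congr (_ + _); rewrite addrCA.
have k1 : nr k <= 2 * s * nr x.
  apply: le_trans (nrB _ _) _; rewrite !nrZ nrJ nrNs.
  have := ler_wpM2l (nr_ge0 l) (Nb x); rewrite /s; lra.
have k2 : rip x k = 0.
  rewrite /rip /k innerBr !innerZr ReB -[X in _ - X]ReJ !rmorphM /= !conjcK.
  by rewrite -innerC Nadj subrr.
have xk : nr (x + k) <= (1 + 4 * s ^+ 2) * nr x.
  have p0 : 0 <= nr x := nr_ge0 x; have p1 := nr_ge0 k.
  have p2 : 0 <= 1 + 4 * s ^+ 2 by rewrite addr_ge0 // mulr_ge0 // sqr_ge0.
  rewrite -(@ler_pXn2r _ 2) ?nnegrE ?nr_ge0 ?mulr_ge0 // nr_sqrD k2 mulr0 addr0.
  have p3 : nr k ^+ 2 <= (2 * s * nr x) ^+ 2.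
    by rewrite ler_pXn2r ?nnegrE // mulr_ge0 // mulr_ge0.
  apply: le_trans (lerD (lexx _) p3) _.
  have -> : nr x ^+ 2 + (2 * s * nr x) ^+ 2 = (1 + 4 * s ^+ 2) * nr x ^+ 2 by ring.
  rewrite [(_ * nr x) ^+ 2]exprMn; apply: ler_wpM2r; first exact: sqr_ge0.
  have := sqr_ge0 s; nra.
apply: le_trans (nrB _ _) _.
have k3 : nr ((l * l^*) *: Ns (N x)) <= s ^+ 2 * nr x.
  rewrite nrZ nrM nrJ -expr2.
  have -> : s ^+ 2 * nr x = nr l ^+ 2 * (nu * (nu * nr x)) by rewrite /s; ring.
  apply: ler_wpM2l; first exact: sqr_ge0.
  by apply: le_trans (Nsb _) _; apply: ler_wpM2l.
lra.
Qed.

Let sh_skew' l : nbounded (fun x => sh l^* N (sh (- l) Ns x)) (1 + 5 * (nr l * nu) ^+ 2).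
Proof.
move=> x; rewrite shC //.
by have := @sh_skew (- l) x; rewrite rmorphN opprK nrN.
Qed.

(** [1 - l^* N] and [1 + l^* N] are inverse to each other up to the second-order term
    [(l^* N) ^ 2]. *)
Let sh_square l x : nr (sh (- l^*) N (sh l^* N x) - x) <= (nr l * nu) ^+ 2 * nr x.
Proof.
have -> : sh (- l^*) N (sh l^* N x) - x = - (l^* * l^*) *: N (N x).
  rewrite /sh !linD /= scalerA mulrN !scaleNr -!addrA addNKr.
  by rewrite addrCA subrr addr0.
rewrite nrZ nrN nrM nrJ -expr2.
have -> : (nr l * nu) ^+ 2 * nr x = nr l ^+ 2 * (nu * (nu * nr x)) by ring.
apply: ler_wpM2l; first exact: sqr_ge0.
by apply: le_trans (Nb _) _; apply: ler_wpM2l.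
Qed.

Let conj_curve n l x := iter n (sh l Ns) (B (iter n (sh (- l) Ns) x)).

(** Insert [(1 - l^* N)^n (1 + l^* N)^n], nearly the identity, to the right of [B]. As [N] commutes
    with [B], its left factor moves across, and on each side of [B] stand [n] almost norm-preserving
    factors from [sh_skew] and [sh_skew']; this is the first summand. The second is the cost of the
    insertion, with the crude bound [(1 + s) ^ n] on both sides. *)
Let conj_curve_bound n l x s : s = nr l * nu ->
  nr (conj_curve n l x) <=
  ((1 + 5 * s ^+ 2) ^+ n * (1 + 5 * s ^+ 2) ^+ n +
   (1 + s) ^+ n * ((1 + s ^+ 2) ^+ n - 1) * (1 + s) ^+ n) * beta * nr x.
Proof.
move=> sE; set y := iter n (sh (- l) Ns) x.
have s0 : 0 <= s by rewrite sE mulr_ge0 ?nr_ge0.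
have s1 : 0 <= 1 + s by rewrite addr_ge0.
have s2 : 0 <= 1 + 5 * s ^+ 2 by rewrite addr_ge0 // mulr_ge0 // sqr_ge0.
have skew := sh_skew l; have skew' := sh_skew' l; have sq := sh_square l.
have sb := shb l Nsb; have sb' := shb (- l) Nsb.
rewrite nrN in sb'; rewrite -sE in skew skew' sq sb sb'.
have iterD k (A : {linear H -> H}) u v :
    iter n (sh k A) (u - v) = iter n (sh k A) u - iter n (sh k A) v.
  elim: (n) => //= m ->; rewrite /sh linearB scalerBr /= opprD !addrA.
  by congr (_ + _); rewrite addrAC.
pose G u := sh (- l^*) N (sh l^* N u).
have GE u : iter n G u = iter n (sh (- l^*) N) (iter n (sh l^* N) u).
  by rewrite -iter_comp // => v; rewrite shC.
have -> : conj_curve n l x = iter n (sh l Ns) (B (iter n G y)) -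
    iter n (sh l Ns) (B (iter n G y - y)).
  by rewrite -iterD -linearB opprB addrC subrK.
apply: le_trans (nrB _ _) _; rewrite 2!mulrDl; apply: lerD.
  have -> : iter n (sh l Ns) (B (iter n G y)) =
      iter n (fun u => sh l Ns (sh (- l^*) N u))
        (B (iter n (fun u => sh l^* N (sh (- l) Ns u)) x)).
    rewrite -[in RHS]iter_comp; last by move=> v; rewrite shC.
    rewrite -[in RHS]iter_comp; last by move=> v; rewrite shC.
    congr (iter n _ _); rewrite GE -/y.
    elim: (n) (iter n (sh l^* N) y) => //= m IH u.
    by rewrite -IH /sh linD NB.
  apply: le_trans (iter_nbounded _ s2 skew _) _.
  rewrite -!mulrA ler_wpM2l ?exprn_ge0 //.
  apply: le_trans (Bb _) _; rewrite mulrCA ler_wpM2l //.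
  exact: (iter_nbounded _ s2 skew').
apply: le_trans (iter_nbounded _ s1 sb _) _.
rewrite -!mulrA ler_wpM2l ?exprn_ge0 //.
apply: le_trans (Bb _) _; rewrite [X in _ <= _ * X]mulrCA [leRHS]mulrCA ler_wpM2l //.
have e0 : 0 <= s ^+ 2 by apply: sqr_ge0.
apply: le_trans (iter_near_id n e0 sq y) _.
rewrite ler_wpM2l ?subr_ge0 ?exprn_ege1 ?lerDl //.
exact: iter_nbounded.
Qed.

(* Rosenblum's proof with [exp (l Ns)] replaced by [(1 + l Ns / n) ^ n]: the curve
   [(1 + l Ns / n) ^ n B (1 - l Ns / n) ^ n] is a polynomial in [l], almost bounded by
   [beta] on every circle, with linear coefficient [Ns B - B Ns]. *)
Theorem fuglede x : Ns (B x) = B (Ns x).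
Proof.
(* Liouville's argument: a bound on [r * nr c] uniform in [r] forces [c = 0]. *)
suff h r : 0 < r -> r * nr (Ns (B x) - B (Ns x)) <= 2 * beta * nr x.
  apply/eqP; rewrite -subr_eq0; apply/eqP/nr_eq0/eqP; apply/negPn/negP => c0.
  have {}c0 : 0 < nr (Ns (B x) - B (Ns x)) by rewrite lt_neqAle eq_sym c0 nr_ge0.
  have K0 : 0 <= 2 * beta * nr x by rewrite !mulr_ge0 ?nr_ge0.
  have := h ((2 * beta * nr x + 1) / nr (Ns (B x) - B (Ns x))).
  rewrite divfK ?gt_eqF // divr_gt0 ?ltr_wpDl // => /(_ isT).
  by rewrite gerDl ler10.
move=> r0; have [n n0 hn] := fuglede_estimate (mulr_ge0 (ltW r0) nu0).
pose t : R[i] := (n%:R : R)^-1%:C.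
have nR : 0 < n%:R :> R by rewrite ltr0n.
have tn : n%:R * t = 1.
  by rewrite /t -(rmorph_nat (real_complex R)) -rmorphM /= mulfV ?gt_eqF.
have : pcurve (fun l => conj_curve n (l * t) x) (B x) (Ns (B x) - B (Ns x)).
  have := pcurve_iter (- t \*: Ns) n (pcurve_cst x).
  move=> /(pcurve_linear B) /(pcurve_iter (t \*: Ns) n).
  rewrite /= add0r scalerA scalerA mulrN tn scaleN1r scale1r linearN addrC.
  congr pcurve; apply/funext => l; rewrite /conj_curve.
  congr (iter n _ (B (iter n _ x))); apply/funext => u; rewrite /sh scalerA //.
  by rewrite mulrN.
move=> [d [c [d1 _ <- hc]]]; apply: (cauchy_estimate d1 r0) => l lr.
have sE : r * nu / n%:R = nr (l * t) * nu.
  by rewrite nrM lr nr_real ger0_norm ?invr_ge0 ?ltW // mulrAC.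
rewrite -hc; apply: le_trans (conj_curve_bound _ _ sE) _.
by apply: ler_wpM2r; [exact: nr_ge0|apply: ler_wpM2r].
Qed.

End Fuglede.

(** * Joint approximate eigenvectors *)

Lemma linear_addZ (R : pzRingType) (V W : lmodType R) (A : {linear V -> W}) a x y :
  A (x + a *: y) = A x + a *: A y.
Proof. by rewrite linearD [A (a *: y)]linearZ. Qed.

Lemma linear_subZ (R : pzRingType) (V W : lmodType R) (A : {linear V -> W}) a x y :
  A (x - a *: y) = A x - a *: A y.
Proof. by rewrite -!scaleNr linear_addZ. Qed.

Lemma shift_addZ (R : comPzRingType) (V : lmodType R) (A : {linear V -> V}) s t x y :
  A (x + t *: y) - s *: (x + t *: y) = (A x - s *: x) + t *: (A y - s *: y).
Proof.
by rewrite linear_addZ scalerDr scalerBr !scalerA (mulrC t) opprD addrACA.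
Qed.

Section Localization.
Variables (R : realType) (H : hilbertType R).
Implicit Types (q : H -> R) (S : H -> H).

(** In use, [q x] adds up the defects [nr (S x - s *: x)] of the operators already localized.
    [singular] says that unit vectors make them arbitrarily small, [stable] that applying [S]
    preserves this smallness. *)
Definition seminorm q := [/\ forall x, 0 <= q x, q 0 = 0 &
  forall (t : R[i]) x y, q (x + t *: y) <= q x + nr t * q y].

Definition stable q S := exists2 M, 0 <= M & forall x, q (S x) <= M * q x.

Definition singular q := forall e, 0 < e -> exists2 x : H, nr x = 1 & q x <= e.

Definition selfadjoint S := forall x y, inner (S x) y = inner x (S y).

Lemma seminorm0 : seminorm (fun=> 0).
Proof. by split=> // t x y; rewrite mulr0 addr0. Qed.

Lemma seminorm_add q (S : {linear H -> H}) (s : R[i]) : seminorm q ->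
  seminorm (fun x => q x + nr (S x - s *: x)).
Proof.
move=> [q0 q00 qD]; split=> [x||t x y]; first by rewrite addr_ge0 ?nr_ge0.
  by rewrite q00 linear0 scaler0 subr0 nr0 addr0.
rewrite shift_addZ mulrDr addrACA; apply: lerD (qD _ _ _) _.
by rewrite -nrZ; apply: nrD.
Qed.

Lemma stable0 S : stable (fun=> 0) S.
Proof. by exists 0 => // x; rewrite mul0r. Qed.

Lemma stable_lin q S S' (c : R[i]) : seminorm q -> stable q S -> stable q S' ->
  stable q (fun x => S x + c *: S' x).
Proof.
move=> [q0 _ qD] [M M0 hM] [M' M'0 hM']; exists (M + nr c * M').
  by rewrite addr_ge0 // mulr_ge0 ?nr_ge0.
move=> x; apply: le_trans (qD _ _ _) _; rewrite mulrDl; apply: lerD (hM x) _.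
by rewrite -mulrA ler_wpM2l ?nr_ge0.
Qed.

Lemma stable_add q (A B : {linear H -> H}) (M : R) (a : R[i]) :
  (forall x, 0 <= q x) -> stable q B -> nbounded B M ->
  (forall x, A (B x) = B (A x)) -> stable (fun x => q x + nr (A x - a *: x)) B.
Proof.
move=> q0 [M' M'0 hM'] hM AB; exists (M' + `|M|); first by rewrite addr_ge0.
move=> x.
have -> : A (B x) - a *: B x = B (A x - a *: x) by rewrite linear_subZ AB.
have h1 := hM' x; have h2 := hM (A x - a *: x); have h3 := q0 x.
have h4 := nr_ge0 (A x - a *: x); have h5 := ler_norm M; have h6 := normr_ge0 M.
nra.
Qed.

Lemma singular_le q q' : (forall x, q' x <= q x) -> singular q -> singular q'.
Proof.
by move=> h sq e /sq[x x1 qx]; exists x => //; apply: le_trans (h x) qx.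
Qed.

Lemma rip_bound (S : H -> H) M x : nbounded S M -> `|rip (S x) x| <= M * nr x ^+ 2.
Proof.
move=> h; have h1 := ler_wpM2r (nr_ge0 x) (h x).
rewrite ler_norml lerNl -ripNl; apply/andP; split;
  apply: le_trans (cauchy_schwarz_rip _ _) _; rewrite ?nrN expr2; lra.
Qed.

(* The point [s] is the largest possible limit of [rip (S x) x] along unit
   vectors with [q x] tending to 0; first-order optimality makes maximizers
   approximate eigenvectors. *)
Lemma selfadjoint_localize q (S : {linear H -> H}) M :
  seminorm q -> singular q -> selfadjoint S -> nbounded S M -> stable q S ->
  exists s : R,
    (forall m, (forall e, 0 < e -> exists x, [/\ nr x = 1, q x <= e & m <= rip (S x) x]) ->
      m <= s) /\ singular (fun x => q x + nr (S x - s%:C *: x)).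
Proof.
move=> [q0 q00 qD] sq sa SM [C C0 qC].
pose A : set R := [set m | forall e, 0 < e ->
  exists x, [/\ nr x = 1, q x <= e & m <= rip (S x) x]].
have supA : has_sup A.
  split.
    exists (- M) => e /sq[x x1 qx]; exists x; split=> //.
    by have := rip_bound x SM; rewrite x1 expr1n mulr1 ler_norml => /andP[].
  exists M => m /(_ 1 ltr01)[x [x1 _ mx]]; apply: le_trans mx _.
  by have := rip_bound x SM; rewrite x1 expr1n mulr1 ler_norml => /andP[].
pose s := sup A; exists s; split; first by move=> m mA; apply: ub_le_sup mA; case: supA.
have qZ (t : R) x : q (t%:C *: x) <= `|t| * q x.
  by have := qD t%:C 0 x; rewrite q00 !add0r nr_real.
pose K := `|M| + `|s| + 1.
have K1 : 1 <= K by rewrite /K lerDr addr_ge0.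
have K0 : 0 < K by apply: lt_le_trans K1.
have [S' S'E] : exists S' : H -> H, forall x, S' x = S x - s%:C *: x by eexists.
have S'K : nbounded S' K.
  move=> x; rewrite S'E; apply: le_trans (nrB _ _) _; rewrite nrZ nr_real.
  have := SM x; have := nr_ge0 x; have := ler_norm M; rewrite /K; nra.
have S'q x : q (S' x) <= (C + `|s|) * q x.
  have := qD (- s%:C) (S x) x; rewrite scaleNr nrN nr_real.
  have := qC x; rewrite S'E; lra.
have S'sa x y : rip (S' x) y = rip x (S' y).
  by rewrite !S'E !ripE /rip sa.
have ripS' x : rip (S' x) x = rip (S x) x - s * nr x ^+ 2.
  by rewrite S'E !ripE rip_nr.
(* As [s + d] is not in [A], unit vectors with small [q] have form value below [s + d]; homogeneity
   turns this into a statement about all vectors. *)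
have upper d : 0 < d -> exists2 e, 0 < e &
    forall x, q x <= e * nr x -> rip (S' x) x <= d * nr x ^+ 2.
  move=> d0; have nA : ~ A (s + d).
    move=> /(ub_le_sup supA.2); rewrite -/s; lra.
  have [e [e0 he]] : exists e, 0 < e /\ ~ exists x,
      [/\ nr x = 1, q x <= e & s + d <= rip (S x) x].
    apply: contrapT => h; apply: nA => e e0; apply: contrapT => h'.
    by apply: h; exists e.
  exists e => // x qx; rewrite ripS'.
  have [->|x0] := eqVneq x 0; first by rewrite linear0 nr0 /rip inner0l expr0n !mulr0 subr0.
  have nx := nr_gt0 x0.
  pose y := (nr x)^-1%:C *: x.
  have xy : x = (nr x)%:C *: y.
    by rewrite scalerA -rmorphM /= mulfV ?gt_eqF // scale1r.
  have y1 : nr y = 1.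
    by rewrite nrZ nr_real ger0_norm ?invr_ge0 ?ltW // mulVf ?gt_eqF.
  have qy : q y <= e.
    apply: le_trans (qZ _ _) _; rewrite ger0_norm ?invr_ge0 ?nr_ge0 //.
    by rewrite ler_pdivrMl // mulrC.
  have Sy : rip (S y) y < s + d.
    by rewrite ltNge; apply/negP => h; apply: he; exists y.
  have -> : rip (S x) x = nr x ^+ 2 * rip (S y) y.
    rewrite {1 2}xy linearZ /= !ripE; ring.
  have : 0 < nr x ^+ 2 by rewrite exprn_gt0.
  nra.
move=> e e0.
(* Move an almost maximizing [x] by [tau] in the gradient direction [y = S' x]. The form gains
   [2 tau |y|^2] up to an error of [tau |y|^2 / 4], yet [upper] caps it, whence
   [tau |y|^2 <= 3 d / 2]. With this [d] and [tau = 1 / (4 K)] that reads [|y| <= e / 2]. *)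
pose d := e ^+ 2 / (24 * K).
have d0 : 0 < d by rewrite divr_gt0 ?exprn_gt0 // mulr_gt0.
have [e1 e10 he1] := upper _ d0.
pose tau := 1 / (4 * K).
have tauK : tau * K = 1 / 4 by rewrite /tau; field; rewrite gt_eqF.
have tau0 : 0 < tau by rewrite divr_gt0 // mulr_gt0.
pose L := 1 + tau * (C + `|s|).
have L0 : 0 < L by rewrite ltr_wpDr // mulr_ge0 ?addr_ge0 // ltW.
(* The first bound controls the term [q x] of the goal; the second gives [q u <= e1 * nr u] for the
   moved vector [u], since [q u <= L * q x] and [nr u >= 3 / 4]. *)
pose e2 := Order.min (e / 2) (e1 * (3 / 4) / L).
have e20 : 0 < e2.
  rewrite lt_min; apply/andP; split; first by rewrite divr_gt0.
  by rewrite divr_gt0 // mulr_gt0 // divr_gt0.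
have [m mA ms] := sup_adherent d0 supA; rewrite -/s in ms.
have [x [x1 qx mx]] := mA _ e20.
exists x => //; rewrite -S'E; set y := S' x.
have qx1 : q x <= e / 2 by apply: le_trans qx _; rewrite ge_min lexx.
have qx2 : L * q x <= e1 * (3 / 4).
  rewrite mulrC -ler_pdivlMr //; apply: le_trans qx _; by rewrite ge_min lexx orbT.
suff : nr y <= e / 2 by lra.
have yK : nr y <= K by have := S'K x; rewrite x1 mulr1.
pose u := x + tau%:C *: y.
have y0 := nr_ge0 y.
have ny : nr (tau%:C *: y) <= 1 / 4.
  rewrite nrZ nr_real gtr0_norm // -tauK; exact: ler_wpM2l (ltW tau0) _ _ yK.
have u1 : nr u <= 5 / 4 by have := nrD x (tau%:C *: y); rewrite x1 /u; lra.
have u2 : 3 / 4 <= nr u.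
  have := nr_sub x (- (tau%:C *: y)); rewrite opprK nrN x1 -/u; lra.
have qu : q u <= e1 * nr u.
  have h1 := qD tau%:C x y; have h2 := S'q x.
  have h3 : tau * q y <= tau * ((C + `|s|) * q x) by rewrite ler_pM2l.
  have h4 : e1 * (3 / 4) <= e1 * nr u by rewrite ler_pM2l.
  rewrite nr_real gtr0_norm // in h1; rewrite /L in qx2; rewrite -/u in h1; lra.
have h1 := he1 _ qu.
have : rip (S' u) u = rip y x + 2 * tau * nr y ^+ 2 + tau ^+ 2 * rip (S' y) y.
  have -> : S' u = y + tau%:C *: S' y by rewrite /u S'E shift_addZ -!S'E.
  by rewrite /u !ripE (S'sa y x) rip_nr; ring.
move=> h2.
have h3 : - d <= rip y x.
  rewrite /y ripS' x1 expr1n mulr1; lra.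
have h4 : - (K * nr y ^+ 2) <= rip (S' y) y.
  by have := rip_bound y S'K; rewrite ler_norml => /andP[].
have h5 : tau ^+ 2 * (- (K * nr y ^+ 2)) <= tau ^+ 2 * rip (S' y) y.
  by rewrite ler_wpM2l ?sqr_ge0.
have h6 : tau ^+ 2 * (- (K * nr y ^+ 2)) = - (1 / 4 * (tau * nr y ^+ 2)).
  by rewrite -tauK; ring.
have h7 : d * nr u ^+ 2 <= d * (25 / 16).
  rewrite ler_pM2l //; have := nr_ge0 u; nra.
have h8 : tau * nr y ^+ 2 <= 3 / 2 * d by lra.
have h9 : nr y ^+ 2 <= (e / 2) ^+ 2.
  rewrite -(ler_pM2l tau0); apply: le_trans h8 _.
  by rewrite /d /tau le_eqVlt; apply/orP; left; apply/eqP; field; rewrite gt_eqF.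
by rewrite -(@ler_pXn2r _ 2) ?nnegrE // ltW // divr_gt0.
Qed.

(** Localize the commuting selfadjoint operators [S1 = N + Ns] and [S2 = 'i (N - Ns)] in turn; then
    [N = (S1 - 'i S2) / 2] has the corresponding approximate eigenvalue. *)
Lemma normal_localize q (N : bop H H) :
  normal_op N -> seminorm q -> singular q -> stable q N -> stable q (adjoint N) ->
  exists a : R[i], singular (fun x => q x + nr (N x - a *: x)).
Proof.
move=> nN sq gq qN qNs; have [q0 _ _] := sq.
have [M M0 NM] := bop_bounded N; have NsM := adjoint_nbounded (ltW M0) NM.
pose Ns : {linear H -> H} := adjoint N.
pose S1 : {linear H -> H} := N \+ Ns.
pose S2 : {linear H -> H} := 'i%C \*: (N \- Ns).
have S1b : nbounded S1 (M + M).
  by move=> x; apply: le_trans (nrD _ _) _; rewrite mulrDl; apply: lerD; [exact: NM|exact: NsM].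
have S2b : nbounded S2 (M + M).
  by move=> x; rewrite /S2 /= nrZ nr_i mul1r; apply: le_trans (nrB _ _) _; rewrite mulrDl; apply: lerD; [exact: NM|exact: NsM].
have S1sa : selfadjoint S1.
  by move=> x y; rewrite /S1 /= innerDl innerDr adjointP adjointPr addrC.
have S2sa : selfadjoint S2.
  move=> x y; rewrite /S2 /= innerZl innerIr innerBl innerBr adjointP adjointPr.
  by rewrite -mulrN opprB.
have S12 x : S1 (S2 x) = S2 (S1 x).
  rewrite /S1 /S2 /= !(linearZ_LR N) !(linearZ_LR Ns) -scalerDr; congr (_ *: _).
  rewrite (linearB N) (linearB Ns) (linearD N) (linearD Ns) /= /Ns nN.
  by rewrite opprD !addrA; congr (_ - _); rewrite addrNK addrK.
have qS1 : stable q S1.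
  have [K K0 h] := stable_lin 1 sq qN qNs.
  by exists K => // x; have := h x; rewrite scale1r.
have qS2 : stable q S2.
  have [K K0 h] := stable_lin (-1) sq qN qNs; have [_ q00 qD] := sq.
  exists K => // x; have := qD 'i%C 0 (N x - Ns x).
  rewrite q00 !add0r nr_i mul1r => /le_trans; apply.
  by have := h x; rewrite scaleN1r.
have [s1 [_ g1]] := selfadjoint_localize sq gq S1sa S1b qS1.
have sq1 := seminorm_add S1 s1%:C sq.
have qS12 := stable_add s1%:C q0 qS2 S2b S12.
have [s2 [_ g2]] := selfadjoint_localize sq1 g1 S2sa S2b qS12.
exists ((1 / 2 : R)%:C * (s1%:C - 'i%C * s2%:C)).
apply: singular_le g2 => x.
rewrite -addrA lerD2l.
have -> : N x - ((1 / 2 : R)%:C * (s1%:C - 'i%C * s2%:C)) *: x =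
    (1 / 2 : R)%:C *: ((S1 x - s1%:C *: x) - 'i%C *: (S2 x - s2%:C *: x)).
  have half (u : H) : u = (1 / 2 : R)%:C *: (u + u).
    by rewrite scalerDr -scalerDl -rmorphD /= -splitr scale1r.
  have key : S1 x - 'i%C *: S2 x = N x + N x.
    rewrite /S1 /S2 /= scalerA -expr2 sqr_i scaleN1r opprK addrACA subrr addr0.
    by [].
  rewrite [N x]half -key -scalerA -scalerBr; congr (_ *: _).
  rewrite scalerBr scalerBl -[(_ * s2%:C) *: x]scalerA !opprB.
  by rewrite [LHS]addrACA [RHS]addrACA; congr (_ + _); rewrite addrC.
rewrite nrZ nr_real ger0_norm //.
have := nrB (S1 x - s1%:C *: x) ('i%C *: (S2 x - s2%:C *: x)); rewrite nrZ nr_i mul1r.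
have := nr_ge0 (S1 x - s1%:C *: x); have := nr_ge0 (S2 x - s2%:C *: x); lra.
Qed.

End Localization.

(** * The Taylor spectrum of commuting normal operators *)

Section OperatorAlgebra.
Variable R : realType.

Section Compose.
Variables (H K L : hilbertType R) (A : bop K L) (B : bop H K).

Fact bcomp_continuous : continuous (A \o B).
Proof.
by move=> x; apply: continuous_comp; [exact: bop_continuous|exact: bop_continuous].
Qed.

Definition bcomp : bop H L := @Bop R H L (A \o B) bcomp_continuous.

End Compose.

Section Subtract.
Variables (H K : hilbertType R) (A B : bop H K).

Fact bsub_continuous : continuous (A \- B).
Proof. by move=> x; apply: cvgB; exact: bop_continuous. Qed.

Definition bsub : bop H K := @Bop R H K (A \- B) bsub_continuous.

End Subtract.

Fact bid_continuous (H : hilbertType R) : continuous (@idfun H).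
Proof. by move=> x. Qed.

Definition bid (H : hilbertType R) : bop H H := @Bop R H H idfun (@bid_continuous H).

Variable H : hilbertType R.
Implicit Types (A B N : bop H H).

Definition bcommute A B := forall x, A (B x) = B (A x).

Lemma bcommute_sym A B : bcommute A B -> bcommute B A.
Proof. by move=> h x; rewrite h. Qed.

Lemma bcommute_adj A B : bcommute A B -> bcommute (adj A) (adj B).
Proof.
by move=> h x; apply: inner_ext => y /=; rewrite -!adjointP h.
Qed.

Lemma bcommute_fuglede N B : normal_op N -> bcommute N B -> bcommute (adj N) B.
Proof.
move=> nN NB x; have [nu /ltW nu0 Nb] := bop_bounded N; have [b /ltW b0 Bb] := bop_bounded B.
by apply: (fuglede (N := N) (Ns := adj N) (adjointP N) (fun y => esym (nN y)) NB nu0 b0 Nb Bb).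
Qed.

Lemma bcommute_fugledeC N B : normal_op N -> bcommute N B -> bcommute N (adj B).
Proof. by move=> nN /(bcommute_fuglede nN)/bcommute_adj h x; have := h x; rewrite /= !adjointK. Qed.

Lemma bcommute_bcomp A B C : bcommute A B -> bcommute A C -> bcommute A (bcomp B C).
Proof. by move=> h h' x /=; rewrite h h'. Qed.

Lemma bcommute_bsub A B C : bcommute A B -> bcommute A C -> bcommute A (bsub B C).
Proof. by move=> h h' x /=; rewrite linearB /= h h'. Qed.

Lemma bcommute_bid A : bcommute A (bid H).
Proof. by []. Qed.

Lemma nr_adjoint N x : normal_op N -> nr (adjoint N x) = nr (N x).
Proof.
move=> nN; apply/eqP; rewrite -(@eqrXn2 _ 2) ?nr_ge0 //; apply/eqP.
by rewrite -!rip_nr /rip -adjointP -nN -adjointPr.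
Qed.

(** [N - z] is normal too: approximate eigenvectors of [N] are approximate eigenvectors of its
    adjoint, for the conjugate value. *)
Lemma nr_adjoint_normal N (z : R[i]) x : normal_op N ->
  nr (adjoint N x - z^* *: x) = nr (N x - z *: x).
Proof.
move=> nN; apply/eqP; rewrite -(@eqrXn2 _ 2) ?nr_ge0 //; apply/eqP.
have e2 : complex.Re (inner (adjoint N x) (z^* *: x)) = complex.Re (inner (N x) (z *: x)).
  by rewrite -/(rip _ _) ripC /rip innerZl -adjointP innerZr.
by rewrite !nr_sqrD !ripNr !nrN !nrZ nrJ nr_adjoint // /rip e2.
Qed.

End OperatorAlgebra.

Section JointLocalization.
Variables (R : realType) (H : hilbertType R) (n : nat) (A : n.-tuple (bop H H)).
Hypotheses (Acom : commuting A) (Anorm : forall i, normal_op (tnth A i)).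

Definition localizing (q : H -> R) := [/\ seminorm q, singular q &
  forall i, stable q (tnth A i) /\ stable q (adjoint (tnth A i))].

(** By Fuglede's theorem the adjoints also commute with [tnth A i], so the enlarged seminorm stays
    stable under all entries and their adjoints and the step can be repeated. *)
Lemma localizing_step q i : localizing q ->
  exists a : R[i], localizing (fun x => q x + nr (tnth A i x - a *: x)).
Proof.
move=> [sq gq qA]; have [qi qis] := qA i.
have [a ga] := normal_localize (Anorm i) sq gq qi qis; exists a.
have [q0 _ _] := sq.
split=> // [|j]; first exact: seminorm_add.
have [qj qjs] := qA j; have ij : bcommute (tnth A i) (tnth A j) by move=> x; apply: Acom.
have [M /ltW M0 hM] := bop_bounded (tnth A j); split.
  by apply: stable_add hM _.
by apply: (stable_add a q0 (B := adj _) qjs (adjoint_nbounded M0 hM)); apply: bcommute_fugledeC.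
Qed.

Lemma localizing_seq q (s : seq 'I_n) : localizing q ->
  exists q' (z : 'I_n -> R[i]), [/\ localizing q', forall x, q x <= q' x &
    forall i x, i \in s -> nr (tnth A i x - z i *: x) <= q' x].
Proof.
move=> lq; elim: s => [|i s [q' [z [lq' qq' h]]]]; first by exists q, (fun=> 0).
have [a la] := localizing_step i lq'.
exists (fun x => q' x + nr (tnth A i x - a *: x)), (fun j => if j == i then a else z j).
split=> // [x|j x]; first by rewrite ler_wpDr ?nr_ge0.
rewrite inE; have [-> _|_ /= js] := eqVneq j i.
  by rewrite ler_wpDl //; case: lq' => -[].
by rewrite ler_wpDr ?nr_ge0 // h.
Qed.

Lemma joint_localize q : localizing q ->
  exists z : n.-tuple R[i], forall e, 0 < e ->
    exists x, [/\ nr x = 1, q x <= e & forall i, nr (tnth A i x - tnth z i *: x) <= e].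
Proof.
move=> /(localizing_seq (enum 'I_n))[q' [z [[_ gq' _] qq' h]]].
exists [tuple z i | i < n] => e /gq'[x x1 qx]; exists x; split=> // [|i].
  exact: le_trans qx.
by rewrite tnth_mktuple; apply: le_trans qx; apply: h; rewrite mem_enum.
Qed.

End JointLocalization.

(** * A gliding hump *)

Section Hump.
Variables (R : realType) (H : hilbertType R).

Lemma bernoulli (x : R) n : 0 <= x -> 1 + n%:R * x <= (1 + x) ^+ n.
Proof.
move=> x0; elim: n => [|n IH]; first by rewrite mul0r addr0 expr0.
rewrite exprS -natr1.
have : (1 + x) * (1 + n%:R * x) <= (1 + x) * (1 + x) ^+ n by rewrite ler_wpM2l // addr_ge0.
have : 0 <= n%:R * x ^+ 2 by rewrite mulr_ge0 ?sqr_ge0.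
lra.
Qed.

Lemma geometric_lt (d : R) k : 0 < d -> exists2 m, (k <= m)%N & (1 / 3) ^+ m < d.
Proof.
move=> d0; pose m := maxn k (Num.truncn d^-1); exists m; first exact: leq_maxl.
have h : d^-1 < 3 ^+ m.
  apply: lt_le_trans (truncnS_gt _) _.
  have := @bernoulli 2 m (ler0n _ 2); rewrite -[(1 + 2)]/(1 + 2%:R).
  have -> : (1 + 2 : R) = 3 by lra.
  move=> /(le_trans _); apply.
  have : (Num.truncn d^-1)%:R <= m%:R :> R by rewrite ler_nat leq_maxr.
  have : 0 <= m%:R :> R by [].
  rewrite -natr1; lra.
rewrite expr_div_n expr1n div1r -[d]invrK ltf_pV2 ?posrE ?invr_gt0 ?exprn_gt0 //.
Qed.

(* Sokal's proof of the uniform boundedness principle: choosing signs greedily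
   keeps every pairing with [u k] above the tail of the series. *)
Lemma gliding_hump (u : nat -> H) : (forall k, nr (u k) = 1) ->
  exists y, forall k, (1 / 3) ^+ k / 2 <= nr (inner y (u k)).
Proof.
move=> u1; pose t k : R := (1 / 3) ^+ k.
have t0 k : 0 < t k by rewrite exprn_gt0.
have tS k : t k.+1 = t k / 3 by rewrite /t exprS; lra.
pose next k x := if t k <= nr (inner (x + (t k)%:C *: u k) (u k))
  then x + (t k)%:C *: u k else x - (t k)%:C *: u k.
have next1 k x : nr (next k x - x) = t k.
  have e : nr ((t k)%:C *: u k) = t k by rewrite nrZ nr_real u1 mulr1 gtr0_norm.
  by rewrite /next; case: ifP => _; rewrite addrC addKr ?nrN.
(* The pairings of the two candidates with [u k] differ by [2 * t k], so one of them has modulus at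
   least [t k]. *)
have next2 k x : t k <= nr (inner (next k x) (u k)).
  rewrite /next; case: ifPn => //; rewrite -ltNge innerBl innerDl innerZl.
  rewrite inner_nr u1 expr1n mulr1; set a := inner x _ => h.
  have := nrB (a + (t k)%:C) (a - (t k)%:C).
  have -> : a + (t k)%:C - (a - (t k)%:C) = (t k + t k)%:C.
    by rewrite rmorphD /= opprB addrC addrA subrK.
  rewrite nr_real ger0_norm ?addr_ge0 ?(ltW (t0 k)) //; have := t0 k; lra.
pose x := fix x k := if k is k'.+1 then next k' (x k') else 0.
have xS k : x k.+1 = next k (x k) by [].
have xd k j : nr (x (k + j)%N - x k) <= 3 / 2 * (t k - t (k + j)%N).
  elim: j => [|j IH]; first by rewrite addn0 !subrr nr0 mulr0.
  rewrite addnS xS -(subrK (x (k + j)%N) (next _ _)) -addrA.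
  apply: le_trans (nrD _ _) _; rewrite next1 tS; lra.
have xd' k m : (k <= m)%N -> nr (x m - x k) < 3 / 2 * t k.
  by move=> km; have := xd k (m - k)%N; rewrite subnKC // => h; have := t0 m; lra.
(* The tails of the sequence [x], indexed by a threshold [d] on the remainder [3 / 2 * t m]. *)
have [l hl] : exists l, forall e, 0 < e -> exists2 d, 0 < d &
    forall y, [set x m | m in [set m | 3 / 2 * t m < d]] y -> nr (l - y) < e.
  apply: (@cantor_complete _ H (fun d => [set x m | m in [set m | 3 / 2 * t m < d]])).
  - move=> d d0; have [|m _ hm] := @geometric_lt (2 / 3 * d) 0; first by rewrite mulr_gt0.
    by exists (x m); exists m => //=; rewrite /t; lra.
  - by move=> d d' dd _ [m /= hm <-]; exists m => //=; apply: lt_le_trans hm _.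
  - move=> e e0; exists e => // _ _ [m /= hm <-] [k /= hk <-].
    case: (leqP k m) => km; first by apply: lt_trans (xd' _ _ km) _.
    by rewrite nrC; apply: lt_trans (xd' _ _ (ltnW km)) _.
exists l => k; rewrite -/(t k).
(* The remaining terms add up to at most [3 / 2 * t k.+1 = t k / 2], which leaves half of the
   pairing [t k]. *)
have lk : nr (l - x k.+1) <= t k / 2.
  apply/ler_addgt0Pr => e e0; have [d d0 h] := hl _ e0.
  have [|m km hm] := @geometric_lt (2 / 3 * d) k.+1; first by rewrite mulr_gt0.
  have hm' : nr (l - x m) < e by apply: h; exists m => //=; rewrite /t; lra.
  have := nrD (l - x m) (x m - x k.+1); rewrite subrKA.
  have := xd' _ _ km; rewrite tS; lra.
have := next2 k (x k); rewrite -xS.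
have := nrD (inner l (u k)) (inner (x k.+1 - l) (u k)).
rewrite -innerDl addrC subrK.
have := cauchy_schwarz (x k.+1 - l) (u k); rewrite u1 mulr1 nrC; lra.
Qed.

End Hump.

Section ApproximateSpectrum.
Variables (R : realType) (H : hilbertType R) (n : nat) (A : n.-tuple (bop H H)).

(** A cochain supported on the full index set is a cocycle, because the differential only evaluates
    it at sets with an index removed. Exactness makes it a coboundary; the signs are absorbed into
    [v]. *)
Lemma koszul_exact_top (B : 'I_n -> {linear H -> H}) : koszul_exact (fun i x => B i x) ->
  forall y, exists v : 'I_n -> H, y = \sum_i B i (v i).
Proof.
move=> ex y; pose w (I : {set 'I_n}) := if I == [set: 'I_n]%SET then y else 0.
have [|v hv] := ex w.
  move=> I; apply: big1 => i iI; rewrite /w ifN ?linear0 ?scaler0 //.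
  by apply/negP => /eqP/finset.setP/(_ i); rewrite !inE eqxx.
exists (fun i : 'I_n => (-1) ^+ #|[set j in [set: 'I_n] | (j < i)%N]%SET| *: v ([set: 'I_n] :\ i)%SET).
have := hv [set: 'I_n]%SET; rewrite /w eqxx => ->.
by apply: eq_big => [i|i _]; rewrite ?inE // linearZ.
Qed.

(** If the complex were exact, the vector [y] of the gliding hump would be a sum of
    [(A_i - z_i) v_i]. Moving the operators onto [u k] and using normality bounds the pairing by
    [C / 4 ^ k], while the hump keeps it above [3 ^ (- k) / 2]. *)
Lemma approximate_spectrum (z : n.-tuple R[i]) : (forall i, normal_op (tnth A i)) ->
  (forall e, 0 < e -> exists2 x, nr x = 1 &
     forall i, nr (tnth A i x - tnth z i *: x) <= e) ->
  taylor_spectrum A z.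
Proof.
move=> nA h ex.
pose B i : {linear H -> H} := tnth A i \- (tnth z i \*: idfun).
have {ex} ex : koszul_exact (fun i x => B i x) by [].
have /choice[u hu] : forall k, exists x, nr x = 1 /\
    forall i, nr (tnth A i x - tnth z i *: x) <= (1 / 4) ^+ k.
  by move=> k; have [|x x1 hx] := h ((1 / 4) ^+ k); [rewrite exprn_gt0|exists x].
have [y hy] := gliding_hump (fun k => (hu k).1).
have [v yv] := koszul_exact_top ex y.
pose C := \sum_i nr (v i).
have yC k : nr (inner y (u k)) <= C * (1 / 4) ^+ k.
  have -> : inner y (u k) = \sum_i inner (B i (v i)) (u k).
    by rewrite yv; elim/big_ind2 : _ => [|? ? ? ? <- <-|//]; rewrite ?inner0l ?innerDl.
  apply: le_trans (nr_sum (V := R[i]^o) _ _) _; rewrite mulr_suml; apply: ler_sum => i _.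
  have -> : inner (B i (v i)) (u k) =
      inner (v i) (adjoint (tnth A i) (u k) - (tnth z i)^* *: u k).
    by rewrite /B /= innerBl innerZl adjointP innerBr innerJr.
  apply: le_trans (cauchy_schwarz _ _) _; rewrite nr_adjoint_normal //.
  by rewrite ler_wpM2l ?nr_ge0 //; have [_] := hu k; apply.
have C0 : 0 <= C by apply: sumr_ge0 => i _; apply: nr_ge0.
(* By Bernoulli [(4 / 3) ^ k >= 1 + k / 3 > 2 C], a contradiction. *)
pose k := (Num.truncn (6 * C)).+1.
have k1 : 6 * C < k%:R by apply: truncnS_gt.
have k2 := @bernoulli R (1 / 3) k (ltac:(by rewrite divr_ge0)).
have k3 := le_trans (hy k) (yC k).
have e4 : (1 / 3) ^+ k = (1 + 1 / 3) ^+ k * (1 / 4) ^+ k :> R.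
  by rewrite -exprMn; congr (_ ^+ _); lra.
have p4 : 0 < (1 / 4 : R) ^+ k by rewrite exprn_gt0.
rewrite e4 mulrAC ler_pM2r // in k3.
by clear yv; lra.
Qed.

End ApproximateSpectrum.

Section JointSpectrum.
Variables (R : realType) (H : hilbertType R).

(** Localize [X^* X] first, at an upper bound [s] of its form on unit vectors that is approximately
    attained, and then the entries of [A] along the same vectors. Fuglede's theorem provides
    stability under the adjoints. *)
Lemma joint_spectral_value n (A : n.-tuple (bop H H)) (X : bop H H) (x0 : H) :
  commuting A -> (forall i, normal_op (tnth A i)) ->
  (forall i, bcommute (bcomp (adj X) X) (tnth A i)) -> nr x0 = 1 ->
  exists (s : R) (z : n.-tuple R[i]), [/\ nr (X x0) ^+ 2 <= s, taylor_spectrum A z &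
    forall e, 0 < e -> exists x, [/\ nr x = 1, s - e <= nr (X x) ^+ 2 &
      forall i, nr (tnth A i x - tnth z i *: x) <= e]].
Proof.
move=> cA nA YA x01; set Y := bcomp (adj X) X in YA.
have Ysa : selfadjoint Y by move=> x y; rewrite /= -adjointPr adjointP.
have YX x : rip (Y x) x = nr (X x) ^+ 2 by rewrite /rip /= -adjointPr -rip_nr.
have [M _ YM] := bop_bounded Y.
have g0 : singular (fun _ : H => 0 : R) by move=> e e0; exists x0 => //; apply: ltW.
have [s [s1 gs]] := selfadjoint_localize (seminorm0 H) g0 Ysa YM (stable0 _).
have lq : localizing A (fun x => 0 + nr (Y x - s%:C *: x)).
  split; [exact: seminorm_add (seminorm0 H)|exact: gs|move=> i].
  have [K /ltW K0 hK] := bop_bounded (tnth A i).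
  have zero_ge (x : H) : (0 : R) <= 0 by [].
  split; first exact: (stable_add _ zero_ge (stable0 _) hK (YA i)).
  apply: (stable_add _ zero_ge (B := adj _) (stable0 _) (adjoint_nbounded K0 hK)).
  apply: bcommute_sym; apply: bcommute_fuglede => //; apply: bcommute_sym; exact: YA.
have [z hz] := joint_localize cA nA lq.
exists s, z; split.
- by apply: s1 => e e0; exists x0; split; rewrite ?YX //; apply: ltW.
- by apply: approximate_spectrum => // e /hz[x [x1 _ hx]]; exists x.
- move=> e /hz[x [x1 hs hx]]; exists x; split=> //.
  have := cauchy_schwarz_rip (s%:C *: x - Y x) x.
  by rewrite !ripE rip_nr x1 YX nrC expr1n !mulr1; lra.
Qed.

End JointSpectrum.

(** * Tetrablock unitaries *)

Section TetrablockUnitary.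
Variables (R : realType) (H : hilbertType R) (U : 3.-tuple (bop H H)).
Hypothesis Uunit : tetrablock_unitary U.

Let A := tnth U 0.
Let B := tnth U 1.
Let C := tnth U 2.

Let nU i : normal_op (tnth U i). Proof. by case: Uunit. Qed.
Let cU : commuting U. Proof. by case: Uunit. Qed.

Let cUs i j : bcommute (tnth U i) (adj (tnth U j)).
Proof. by apply: bcommute_fugledeC => // x; apply: cU. Qed.

Let cUadj (X : bop H H) : (forall i, bcommute (tnth U i) X) ->
  forall i, bcommute (bcomp (adj X) X) (tnth U i).
Proof.
by move=> h i; apply/bcommute_sym/bcommute_bcomp => //; apply: bcommute_fugledeC.
Qed.

(* An operator of the von Neumann algebra of [U] vanishes as soon as its symbol
   vanishes on the distinguished boundary. *)
Let vanish (X : bop H H) (K : R) : 0 <= K -> (forall i, bcommute (tnth U i) X) ->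
  (forall z x e, tetrablock_dist_boundary z ->
     (forall i, nr (tnth U i x - tnth z i *: x) <= e) -> nr (X x) <= K * e) ->
  forall x, X x = 0.
Proof.
move=> K0 cX hX x; apply: contrapT => /eqP Xx0.
have x0 : x != 0 by apply: contra_neq Xx0 => ->; rewrite linear0.
pose x1 := (nr x)^-1%:C *: x.
have x11 : nr x1 = 1.
  by rewrite nrZ nr_real ger0_norm ?invr_ge0 ?nr_ge0 // mulVf ?gt_eqF ?nr_gt0.
have [s [z [s1 sz hs]]] := joint_spectral_value cU nU (cUadj cX) x11.
have s0 : 0 < s.
  apply: lt_le_trans s1; rewrite exprn_gt0 // nr_gt0 //.
  rewrite /x1 linearZ /= scaler_eq0 (negbTE Xx0) orbF.
  by rewrite fmorph_eq0 invr_eq0 gt_eqF // nr_gt0.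
have zb : tetrablock_dist_boundary z by case: Uunit => _ _; apply.
(* Then [s - e <= |X y|^2 <= K^2 e^2 <= K^2 e], so [s <= e (K^2 + 1) <= s / 2], against [s > 0]. *)
pose e := Order.min 1 (s / (2 * (K ^+ 2 + 1))).
have K2 : 0 < K ^+ 2 + 1 by rewrite ltr_wpDl ?sqr_ge0.
have e0 : 0 < e by rewrite lt_min ltr01 divr_gt0 // mulr_gt0.
have e1 : e <= 1 by rewrite ge_min lexx.
have e2 : e * (K ^+ 2 + 1) <= s / 2.
  have : e <= s / (2 * (K ^+ 2 + 1)) by rewrite ge_min lexx orbT.
  by rewrite invfM mulrA ler_pdivlMr.
have [y [y1 sy hy]] := hs _ e0.
have h1 := hX z y e zb hy.
have h2 : nr (X y) ^+ 2 <= (K * e) ^+ 2.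
  by rewrite ler_pXn2r ?nnegrE ?nr_ge0 // mulr_ge0 // ltW.
have h3 : (K * e) ^+ 2 <= K ^+ 2 * e.
  rewrite exprMn; apply: ler_wpM2l; first exact: sqr_ge0.
  by rewrite expr2 -[leRHS]mulr1 ler_pM2l.
clear x11 Xx0 x0; lra.
Qed.

Lemma tetrablock_unitary_third x : adjoint C (C x) = x.
Proof.
have [M /ltW M0 hM] := bop_bounded C.
have hMs := adjoint_nbounded M0 hM.
suff h : bsub (bcomp (adj C) C) (bid H) x = 0 by apply/eqP; rewrite -subr_eq0; apply/eqP.
apply: (vanish (K := M + 1)) => [|i|z y e zb hy]; first by rewrite addr_ge0.
  by apply: bcommute_bsub; [apply: bcommute_bcomp; [exact: cUs|move=> w; exact: cU]|exact: bcommute_bid].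
have [_ _ z2] := zb; have {}z2 : nr (tnth z 2) = 1 by rewrite /nr z2.
set c := tnth z 2 in z2.
(* The symbol [|c|^2 - 1] vanishes, so the operator splits into terms each containing a defect of
   [y] as approximate eigenvector. *)
have -> : bsub (bcomp (adj C) C) (bid H) y =
    adj C (C y - c *: y) + c *: (adjoint C y - c^* *: y).
  rewrite linear_subZ scalerBr scalerA.
  have -> : c * c^* = 1.
    by rewrite -sqr_normc nrE z2 expr1n.
  by rewrite scale1r addrA subrK.
apply: le_trans (nrD _ _) _; rewrite nrZ z2 mul1r nr_adjoint_normal; last exact: nU.
rewrite mulrDl mul1r; apply: lerD; last exact: (hy 2).
by apply: le_trans (hMs _) _; apply: ler_wpM2l => //; exact: (hy 2).
Qed.

Lemma tetrablock_unitary_first x : A x = adjoint B (C x).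
Proof.
have [M /ltW M0 hM] := bop_bounded B.
have hMs := adjoint_nbounded M0 hM.
suff h : bsub A (bcomp (adj B) C) x = 0 by apply/eqP; rewrite -subr_eq0; apply/eqP.
apply: (vanish (K := 1 + (M + 1))) => [|i|z y e zb hy].
- by rewrite !addr_ge0.
- by apply: bcommute_bsub; [move=> w; exact: cU|apply: bcommute_bcomp; [exact: cUs|move=> w; exact: cU]].
have [z0 _ z2] := zb; have {}z2 : nr (tnth z 2) = 1 by rewrite /nr z2.
set a := tnth z 0 in z0; set b := tnth z 1 in z0; set c := tnth z 2 in z0 z2.
have -> : bsub A (bcomp (adj B) C) y =
    (A y - a *: y) - (adj B (C y - c *: y) + c *: (adjoint B y - b^* *: y)).
  rewrite linear_subZ scalerBr scalerA.
  by rewrite [_ - _ + (_ - _)]addrA subrK z0 mulrC opprB addrA subrK.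
apply: le_trans (nrB _ _) _; rewrite mulrDl mul1r; apply: lerD (hy 0) _.
apply: le_trans (nrD _ _) _; rewrite nrZ z2 mul1r nr_adjoint_normal; last exact: nU.
rewrite mulrDl mul1r; apply: lerD; last exact: (hy 1).
by apply: le_trans (hMs _) _; apply: ler_wpM2l => //; exact: (hy 2).
Qed.

(** By the first relation, [<A y, C x> = <C y, B C x> = <C y, C B x>], and [C^* C = 1] turns this
    into [<y, B x>]. *)
Lemma tetrablock_unitary_second x : B x = adjoint A (C x).
Proof.
apply: inner_ext => y; rewrite -adjointP tetrablock_unitary_first -(adjointPr B).
have -> : B (C x) = C (B x) by apply: cU.
rewrite adjointP.
have -> : adjoint C (C (B x)) = B x by exact: tetrablock_unitary_third.
by [].
Qed.

(** Some [s >= |B x1|^2] is approximated by [|B y|^2] at joint approximate eigenvectors [y], where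
    [|B y|] is at most [|z_1| + e <= 1 + e]. *)
Lemma tetrablock_unitary_second_contraction x : nr (B x) <= nr x.
Proof.
have [->|x0] := eqVneq x 0; first by rewrite linear0.
pose x1 := (nr x)^-1%:C *: x.
have x11 : nr x1 = 1.
  by rewrite nrZ nr_real ger0_norm ?invr_ge0 ?nr_ge0 // mulVf ?gt_eqF ?nr_gt0.
suff h : nr (B x1) <= 1.
  move: h; rewrite linearZ /= nrZ nr_real ger0_norm ?invr_ge0 ?nr_ge0 //.
  by rewrite ler_pdivrMl ?nr_gt0 // mulr1.
have [s [z [s1 sz hs]]] := joint_spectral_value cU nU (cUadj (fun i => cU i 1)) x11.
have [_ z1 _] : tetrablock_dist_boundary z by case: Uunit => _ _; apply.
have {}z1 : nr (tnth z 1) <= 1 by rewrite -lecR -nrE.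
suff : s <= 1.
  move=> s2; have {}s1 := le_trans s1 s2.
  by rewrite -(@ler_pXn2r _ 2) ?nnegrE ?nr_ge0 // expr1n.
apply/ler_addgt0Pr => e0 e00; pose e := Order.min 1 (e0 / 4).
have e1 : 0 < e by rewrite lt_min ltr01 divr_gt0.
have e2 : e <= 1 by rewrite ge_min lexx.
have e3 : e <= e0 / 4 by rewrite ge_min lexx orbT.
have [y [y1 sy hy]] := hs _ e1.
have h1 := nrD (B y - tnth z 1 *: y) (tnth z 1 *: y).
rewrite subrK nrZ y1 mulr1 in h1.
have h2 := hy 1; rewrite -/B in h2.
have h3 := nr_ge0 (B y).
have h4 : nr (B y) <= 1 + e by lra.
have h5 : nr (B y) ^+ 2 <= (1 + e) ^+ 2.
  by rewrite ler_pXn2r ?nnegrE // addr_ge0 // ltW.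
clear x0 x11; nra.
Qed.

End TetrablockUnitary.

(** * The Taylor spectrum of a pair *)

Section KoszulPair.
Variables (R : realType) (H : hilbertType R).

Lemma koszul_pair (A : 'I_2 -> H -> H) (w : {set 'I_2} -> H) I : koszul A w I =
  (if 0 \in I then A 0 (w (I :\ 0)%SET) else 0) +
  (if 1 \in I then (-1) ^+ (0 \in I) *: A 1 (w (I :\ 1)%SET) else 0).
Proof.
rewrite /koszul big_mkcond /= big_ord_recl big_ord1 /=; congr (_ + _).
  case: ifP => // _; rewrite (_ : #|_| = 0%N) ?expr0 ?scale1r //.
  by apply: eq_card0 => j; rewrite !inE ltn0 andbF.
rewrite (_ : lift ord0 ord0 = 1); last exact: val_inj.
case: ifP => // _; congr (_ ^+ _ *: _).
have lt1 (j : 'I_2) : (j < bump 0 0)%N = (j == 0) by case: j => [[|[|]]].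
case h : (0 \in I).
  apply/eqP/cards1P; exists 0; apply/finset.setP => j; rewrite !inE lt1.
  by have [->|] := eqVneq j 0; rewrite ?h ?andbF.
apply: eq_card0 => j; rewrite !inE lt1.
by have [->|] := eqVneq j 0; rewrite ?h ?andbF.
Qed.

(** Encodes the four subsets by membership of 0 and 1, so that the complex can be treated by case
    analysis on booleans. *)
Definition bits (a b : bool) : {set 'I_2} := [set i : 'I_2 | if i == 0 then a else b]%SET.

Lemma bits0 a b : (0 \in bits a b) = a. Proof. by rewrite inE. Qed.
Lemma bits1 a b : (1 \in bits a b) = b. Proof. by rewrite inE. Qed.

Lemma bitsE (I : {set 'I_2}) : I = bits (0 \in I) (1 \in I).
Proof.
apply/finset.setP => i; rewrite inE; have [->//|i0] := eqVneq i 0.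
by congr (_ \in I); apply: val_inj; case: i i0 => [[|[|]]].
Qed.

Lemma bitsD0 a b : (bits a b :\ 0)%SET = bits false b.
Proof. by apply/finset.setP => i; rewrite !inE; case: eqP. Qed.
Lemma bitsD1 a b : (bits a b :\ 1)%SET = bits a false.
Proof.
apply/finset.setP => i; rewrite !inE.
by case: i => [[|[|]]].
Qed.

Variables (A0 A1 A0s A1s : {linear H -> H}) (c M : R).
Hypotheses (adj0 : forall x y, inner (A0 x) y = inner x (A0s y))
  (adj1 : forall x y, inner (A1 x) y = inner x (A1s y)).
Hypotheses (c00 : forall x, A0 (A0s x) = A0s (A0 x)) (c11 : forall x, A1 (A1s x) = A1s (A1 x))
  (c01 : forall x, A0 (A1 x) = A1 (A0 x)) (c01s : forall x, A0 (A1s x) = A1s (A0 x))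
  (c10s : forall x, A1 (A0s x) = A0s (A1 x)).
Hypothesis c0 : 0 < c.
Hypothesis low : forall x, c * nr x ^+ 2 <= nr (A0 x) ^+ 2 + nr (A1 x) ^+ 2.

Let P : {linear H -> H} := (A0s \o A0) \+ (A1s \o A1).
Hypothesis Pb : nbounded P M.

Let PE x : P x = A0s (A0 x) + A1s (A1 x). Proof. by []. Qed.

Let Pinj x y : P x = P y -> x = y.
Proof.
move=> e; apply/eqP; rewrite -subr_eq0; apply/eqP.
have {}e : P (x - y) = 0 by rewrite linearB e subrr.
have := low (x - y); set u := x - y in e *.
have -> : nr (A0 u) ^+ 2 + nr (A1 u) ^+ 2 = rip u (P u).
  by rewrite PE ripDr -!rip_nr /rip adj0 adj1.
rewrite e /rip inner0r => h; apply/nr_eq0/eqP; rewrite -sqrf_eq0 eq_le sqr_ge0 andbT.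
by rewrite -(pmulr_rle0 _ c0).
Qed.

Let Psurj y : exists x, P x = y.
Proof.
have Psym u v : inner (P u) v = inner u (P v).
  rewrite !PE innerDl innerDr -adj0 -adj1.
  by congr (_ + _); rewrite innerC -?adj0 -?adj1 -innerC.
have Plow u : c * nr u ^+ 2 <= rip (P u) u.
  by apply: le_trans (low u) _; rewrite ripC PE ripDr -!rip_nr /rip adj0 adj1.
have hD u v : inner (u + v) y = inner u y + inner v y by rewrite innerDl.
have hZ a u : inner (a *: u) y = a * inner u y by rewrite innerZl.
have hb u : nr (inner u y) <= nr y * nr u by rewrite mulrC cauchy_schwarz.
have [x hx] := lax_milgram c0 Pb Psym Plow hD hZ hb.
by exists x; apply: inner_ext.
Qed.

(** The Laplacian [P] is invertible and commutes with all the operators, so its inverse composed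
    with the adjoint differential is a contracting homotopy. The vectors [p] and [u] give the values
    of that homotopy on [w], and injectivity of [P] is used to check the components. *)
Lemma koszul_exact_pair (A : 'I_2 -> H -> H) :
  (forall x, A 0 x = A0 x) -> (forall x, A 1 x = A1 x) -> koszul_exact A.
Proof.
move=> E0 E1 w kw.
set w0 := w (bits true false); set w1 := w (bits false true).
set w2 := w (bits true true); set we := w (bits false false).
have k0 : A0 we = 0.
  by have := kw (bits true false); rewrite koszul_pair bits0 bits1 bitsD0 E0 addr0.
have k1 : A1 we = 0.
  have := kw (bits false true); rewrite koszul_pair bits0 bits1 bitsD1 E1 add0r.
  by rewrite expr0 scale1r.
have k2 : A0 w1 = A1 w0.
  have := kw (bits true true); rewrite koszul_pair bits0 bits1 bitsD0 bitsD1 E0 E1.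
  by rewrite expr1 scaleN1r => /eqP; rewrite subr_eq0 => /eqP.
have [p hp] := Psurj (A0s w0 + A1s w1); have [u hu] := Psurj w2.
exists (fun I : {set 'I_2} => if 0 \in I then (if 1 \in I then 0 else - A1s u)
                 else (if 1 \in I then A0s u else p)).
move=> I; rewrite koszul_pair (bitsE I); case: (0 \in I); case: (1 \in I);
  rewrite ?(bits0, bits1, bitsD0, bitsD1) ?E0 ?E1 ?expr0 ?expr1 ?scaleN1r ?scale1r ?addr0 ?add0r.
- by rewrite -/w2 linearN opprK c00 c11 -hu.
- rewrite -/w0; apply: Pinj.
  have -> : P (A0 p) = A0 (P p) by rewrite !PE linearD /= c00 c01s c01.
  by rewrite hp linearD /= c00 c01s k2.
- rewrite -/w1; apply: Pinj.
  have -> : P (A1 p) = A1 (P p) by rewrite !PE linearD /= c11 c10s c01.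
  by rewrite hp linearD /= c11 c10s -k2.
- by apply: Pinj; rewrite -/we PE k0 k1 !linear0 addr0.
Qed.

End KoszulPair.

Section PairSpectrum.
Variables (R : realType) (H : hilbertType R) (A B : bop H H).
Hypotheses (nA : normal_op A) (nB : normal_op B) (AB : bcommute A B).
Hypotheses (ABn : forall x, nr (A x) = nr (B x)) (B1 : forall x, nr (B x) <= nr x).

(** If the moduli differ, [|A x| = |B x|] prevents both defects from being small; if they agree and
    exceed 1, the contraction [B] does. *)
Lemma pair_lower_bound (z0 z1 : R[i]) : ~ (nr z0 = nr z1 /\ nr z1 <= 1) ->
  exists2 d, 0 < d & forall x, d * nr x <= nr (A x - z0 *: x) + nr (B x - z1 *: x).
Proof.
move=> h; have [e|e] := eqVneq (nr z0) (nr z1).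
  exists (nr z1 - 1) => [|x].
    by rewrite subr_gt0 ltNge; apply/negP => z11; apply: h.
  have := nr_sub (z1 *: x) (B x); rewrite nrZ nrC.
  have := B1 x; have := nr_ge0 (A x - z0 *: x); lra.
exists `|nr z0 - nr z1| => [|x]; first by rewrite normr_gt0 subr_eq0.
rewrite -{1}(ger0_norm (nr_ge0 x)) -normrM ler_norml mulrBl -!nrZ.
have := nr_sub (z0 *: x) (A x); have := nr_sub (A x) (z0 *: x); rewrite (nrC (z0 *: x)).
have := nr_sub (z1 *: x) (B x); have := nr_sub (B x) (z1 *: x); rewrite (nrC (z1 *: x)).
by rewrite ABn => *; apply/andP; split; lra.
Qed.

Lemma pair_taylor_spectrum : taylor_spectrum [tuple A; B] `<=`
  [set z : 2.-tuple R[i] | `|tnth z 0| = `|tnth z 1| /\ `|tnth z 1| <= 1].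
Proof.
move=> z /= sz; apply: contrapT => hz; apply: sz.
set z0 := tnth z 0 in hz *; set z1 := tnth z 1 in hz *.
have [|d d0 hd] := @pair_lower_bound z0 z1.
  move=> [h1 h2]; apply: hz; split; first by rewrite !nrE h1.
  by rewrite nrE lecR.
pose A0 : {linear H -> H} := A \- (z0 \*: idfun).
pose A1 : {linear H -> H} := B \- (z1 \*: idfun).
pose A0s : {linear H -> H} := adj A \- (z0^* \*: idfun).
pose A1s : {linear H -> H} := adj B \- (z1^* \*: idfun).
have shC (S S' : bop H H) a b x : bcommute S S' ->
    S (S' x - b *: x) - a *: (S' x - b *: x) = S' (S x - a *: x) - b *: (S x - a *: x).
  move=> h; rewrite (linear_subZ S) (linear_subZ S') h !scalerBr !scalerA (mulrC a) !opprB !addrA.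
  by rewrite [LHS]addrAC [RHS]addrAC; congr (_ + _); rewrite addrAC.
have ABs : bcommute A (adj B) by apply: bcommute_fugledeC.
have BAs : bcommute B (adj A) by apply: bcommute_fugledeC => //; apply: bcommute_sym.
have bd (S : bop H H) (a : R[i]) : exists2 M, 0 <= M & nbounded (fun x => S x - a *: x) M.
  have [M /ltW M0 hM] := bop_bounded S; exists (M + nr a); first by rewrite addr_ge0 ?nr_ge0.
  by move=> x; apply: le_trans (nrB _ _) _; rewrite nrZ mulrDl lerD2r.
have [M hM] : exists M, nbounded ((A0s \o A0) \+ (A1s \o A1)) M.
  have [[a _ ha] [b b0 hb]] := (bd A z0, bd (adj A) z0^*).
  have [[a' _ ha'] [b' b'0 hb']] := (bd B z1, bd (adj B) z1^*).
  exists (b * a + b' * a') => x; apply: le_trans (nrD _ _) _; rewrite mulrDl -!mulrA.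
  apply: lerD.
    by apply: le_trans (hb _) _; apply: ler_wpM2l (ha _).
  by apply: le_trans (hb' _) _; apply: ler_wpM2l (ha' _).
(* The constant [d ^+ 2 / 2] comes from [(a + b)^2 <= 2 (a^2 + b^2)]. *)
apply: (@koszul_exact_pair _ _ A0 A1 A0s A1s (d ^+ 2 / 2) M) => //.
- by move=> x y; rewrite /= innerBl innerBr innerZl innerJr adjointP.
- by move=> x y; rewrite /= innerBl innerBr innerZl innerJr adjointP.
- by move=> x; apply: shC => y /=; rewrite nA.
- by move=> x; apply: shC => y /=; rewrite nB.
- by move=> x; apply: shC.
- by move=> x; apply: shC.
- by move=> x; apply: shC.
- by rewrite divr_gt0 // exprn_gt0.
- move=> x; have := hd x; rewrite -/(A0 x) -/(A1 x) => hdx.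
  have p0 := nr_ge0 x; have p1 := nr_ge0 (A0 x); have p2 := nr_ge0 (A1 x).
  have : (d * nr x) ^+ 2 <= (nr (A0 x) + nr (A1 x)) ^+ 2.
    by rewrite ler_pXn2r ?nnegrE ?addr_ge0 // mulr_ge0 // ltW.
  have := sqr_ge0 (nr (A0 x) - nr (A1 x)); rewrite exprMn; lra.
Qed.

End PairSpectrum.

(** * Dilation of the fundamental operators *)

Section Isometries.
Variables (R : realType).

Lemma inner_rip_ext (H K : hilbertType R) (x y : H) (x' y' : K) :
  rip x y = rip x' y' -> rip ('i%C *: x) y = rip ('i%C *: x') y' -> inner x y = inner x' y'.
Proof.
move=> h1 h2; apply/eqP; rewrite -subr_eq0; apply/eqP/complex_eq0.
  by rewrite ReB -/(rip x y) h1 subrr.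
by rewrite mulrBr -!innerZl ReB -/(rip (_ *: x) y) h2 subrr.
Qed.

Lemma isometric_nr (H K : hilbertType R) (J : bop H K) x : isometric_op J -> nr (J x) = nr x.
Proof. by move=> h; rewrite /nr h. Qed.

Lemma isometric_inner (H K : hilbertType R) (J : bop H K) x y : isometric_op J ->
  inner (J x) (J y) = inner x y.
Proof.
move=> hJ; have h u v : rip (J u) (J v) = rip u v.
  have := nr_sqrD (J u) (J v); rewrite -linearD !(isometric_nr _ hJ) nr_sqrD; lra.
by apply: inner_rip_ext; rewrite -?linearZ /= h.
Qed.

Lemma isometric_adjointK (H K : hilbertType R) (J : bop H K) x : isometric_op J ->
  adjoint J (J x) = x.
Proof. by move=> hJ; apply: adjoint_uniq => y; rewrite isometric_inner. Qed.

(** Polarization: positivity makes [inner (D x) x] real, so the sesquilinear form [b] vanishes on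
    the diagonal, and over the complex numbers this makes it zero. *)
Lemma positive_selfadjoint (H : hilbertType R) (D : bop H H) : positive_op D ->
  forall x y, inner (D x) y = inner x (D y).
Proof.
move=> pD; pose b x y := inner (D x) y - inner x (D y).
have bxx x : b x x = 0.
  have /ger0_real/complex_realP[k hk] := pD x.
  by rewrite /b [inner x _]innerC hk -[(_)^*]/(conjc _) conjc_real subrr.
have bD x y : b x y + b y x = 0.
  have := bxx (x + y); rewrite {1}/b linearD /= !innerDl !innerDr.
  have := bxx x; have := bxx y; rewrite /b => /eqP; rewrite subr_eq0 => /eqP -> /eqP.
  rewrite subr_eq0 => /eqP -> h; rewrite -[RHS]h; ring.
move=> x y; apply/eqP; rewrite -subr_eq0 -/(b x y); apply/eqP.
have h1 := bD x y; have := bD x ('i%C *: y).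
rewrite {1 2}/b !(linearZ_LR D) !innerIr !innerZl => h2.
have h3 : 'i%C * (b y x - b x y) = 0 by rewrite -[RHS]h2 /b; ring.
have i0 : 'i%C != 0 :> R[i] by rewrite eq_complex /= eqxx oner_eq0.
move/eqP: h3; rewrite mulf_eq0 (negbTE i0) subr_eq0 => /eqP h3.
move: h1; rewrite h3 -mulr2n => /eqP; rewrite mulrn_eq0 => /eqP.
by [].
Qed.

End Isometries.

(** * Extension of isometries from a dense range *)

Section DenseRange.
Variables (R : realType) (H H' : hilbertType R) (D : bop H H').
Let W := csType (closure_range D).

Lemma corestrict_dense (x : W) e : 0 < e -> exists h, nr (x - corestrict D h) < e.
Proof.
move=> e0; have /set_mem/= cx := valP x.
have e0' : 0 < e%:C by rewrite ltcR.
have [_ [[h _ <-] hx]] := cx _ (nbhsx_ballx (val x) _ e0').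
by exists h; rewrite -nr_lt; move: hx; rewrite -ball_normE.
Qed.

Lemma corestrict_linear : linear (corestrict D).
Proof. by move=> a x y; apply: val_inj; rewrite /= linearP. Qed.

Lemma corestrict_orthogonal (u : W) : (forall h, inner u (corestrict D h) = 0) -> u = 0.
Proof.
move=> hu; apply: nr_eq0; apply/eqP; rewrite eq_le nr_ge0 andbT.
apply/ler_addgt0Pr => e e0; rewrite add0r.
have [h hh] := corestrict_dense u e0.
have [->|u0] := eqVneq u 0; first by rewrite nr0 ltW.
rewrite -(ler_pM2l (nr_gt0 u0)) -expr2 -rip_nr.
have -> : rip u u = rip u (u - corestrict D h).
  by rewrite /rip innerBr hu subr0.
apply: le_trans (cauchy_schwarz_rip _ _) _.
by rewrite ler_wpM2l ?nr_ge0 // ltW.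
Qed.

Lemma corestrict_inner_ext (x y : W) :
  (forall h, inner x (corestrict D h) = inner y (corestrict D h)) -> x = y.
Proof.
move=> hxy; apply/eqP; rewrite -subr_eq0; apply/eqP/corestrict_orthogonal => h.
by rewrite innerBl hxy subrr.
Qed.

(** Density is used in the second argument directly, and in the first after passing to adjoints. *)
Lemma corestrict_bop_ext (A B : bop W W) :
  (forall h g, inner (A (corestrict D h)) (corestrict D g) =
               inner (B (corestrict D h)) (corestrict D g)) -> forall x, A x = B x.
Proof.
move=> AB x; apply: corestrict_inner_ext => g; rewrite !adjointP.
congr (inner _ _); apply: corestrict_inner_ext => h.
by rewrite -!adjointPr innerC AB -innerC.
Qed.

Variables (F : hilbertType R) (G : {linear H -> F}).
Hypothesis GD : forall h, nr (G h) = nr (D h).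

Let GDB h k : nr (G h - G k) = nr (corestrict D h - corestrict D k).
Proof. by rewrite -linearB GD linearB. Qed.

(** The value of the extension at [x] is described by its distances to all [G h]; isometry and
    linearity are then read off from distances. *)
Let ext_point (x : W) : exists f, forall h, nr (f - G h) = nr (x - corestrict D h).
Proof.
have [f hf] : exists f, forall e, 0 < e -> exists2 d, 0 < d &
    forall y, [set G h | h in [set h | nr (x - corestrict D h) < d]] y -> nr (f - y) < e.
  apply: (@cantor_complete _ F
    (fun d => [set G h | h in [set h | nr (x - corestrict D h) < d]])).
  - by move=> d /(corestrict_dense x)[h hh]; exists (G h); exists h.
  - by move=> d d' dd _ [h /= hh <-]; exists h => //=; apply: lt_le_trans hh _.
  - move=> e e0; exists (e / 2) => [|_ _ [h /= hh <-] [k /= hk <-]]; first by rewrite divr_gt0.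
    rewrite GDB; have := nrD (corestrict D h - x) (x - corestrict D k).
    by rewrite subrKA (nrC (corestrict D h) x); lra.
exists f => h.
have close e : 0 < e -> exists k, nr (x - corestrict D k) < e /\ nr (f - G k) < e.
  move=> e0; have [d d0 hd] := hf _ e0.
  have [|k hk] := @corestrict_dense x (Order.min d e); first by rewrite lt_min d0.
  exists k; split; first by apply: lt_le_trans hk _; rewrite ge_min lexx orbT.
  by apply: hd; exists k => //=; apply: lt_le_trans hk _; rewrite ge_min lexx.
apply/eqP; rewrite eq_le; apply/andP; split; apply/ler_addgt0Pr => e e0.
  have [|k [k1 k2]] := close (e / 2); first by rewrite divr_gt0.
  have := nrD (f - G k) (G k - G h); rewrite subrKA GDB.
  have := nrD (corestrict D k - x) (x - corestrict D h); rewrite subrKA (nrC (corestrict D k) x).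
  lra.
have [|k [k1 k2]] := close (e / 2); first by rewrite divr_gt0.
have := nrD (x - corestrict D k) (corestrict D k - corestrict D h); rewrite subrKA -GDB.
have := nrD (G k - f) (f - G h); rewrite subrKA (nrC (G k) f).
lra.
Qed.

Lemma isometric_extension : exists Lam : bop W F,
  isometric_op Lam /\ forall h, Lam (corestrict D h) = G h.
Proof.
have [L hL] := choice ext_point.
have c0 : corestrict D 0 = 0 by apply: val_inj; rewrite /= linear0.
have Ln x : nr (L x) = nr x by have := hL x 0; rewrite linear0 c0 !subr0.
have Llin : linear L.
  move=> a x y; apply/eqP; rewrite -subr_eq0; apply/eqP/nr_eq0/eqP.
  rewrite eq_le nr_ge0 andbT; apply/ler_addgt0Pr => e e0; rewrite add0r.
  (* Replacing [x] and [y] by [h] and [k] costs [(nr a + 1) * d = e / 2] on each side of the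
     linearity identity. *)
  pose d := e / (2 * (nr a + 1)).
  have a0 := nr_ge0 a.
  have d0 : 0 < d by rewrite divr_gt0 // mulr_gt0 // ltr_wpDl.
  have de : (nr a + 1) * d = e / 2 by rewrite /d; field; rewrite gt_eqF // ltr_wpDl.
  have [h hh] := corestrict_dense x d0; have [k hk] := corestrict_dense y d0.
  have ax := ler_wpM2l a0 (ltW hh).
  have -> : L (a *: x + y) - (a *: L x + L y) =
      (L (a *: x + y) - G (a *: h + k)) - (a *: (L x - G h) + (L y - G k)).
    by rewrite [G (_ + _)]linearP scalerBr [in RHS](addrACA (a *: L x)) -(opprD (a *: G h)) opprB addrA subrK.
  apply: le_trans (nrB _ _) _; rewrite hL.
  have := nrD (a *: (L x - G h)) (L y - G k); rewrite nrZ !hL.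
  have := nrD (a *: (x - corestrict D h)) (y - corestrict D k); rewrite nrZ.
  rewrite corestrict_linear scalerBr addrACA -opprD; lra.
pose Lf : {linear W -> F} := HB.pack L (GRing.isLinear.Build _ _ _ _ L Llin).
have Lb : nbounded Lf 1 by move=> x; rewrite mul1r /= Ln.
exists (bop_of Lb); split => [x|h /=]; first by rewrite /= !nrE Ln.
apply/eqP; rewrite -subr_eq0; apply/eqP/nr_eq0.
by rewrite hL subrr nr0.
Qed.

End DenseRange.

Section Restriction.
Variables (R : realType) (K : hilbertType R) (W : closedSubspace K).

Fact cs_val_nbounded : nbounded (val : csType W -> K) 1.
Proof. by move=> x; rewrite mul1r. Qed.

Definition cs_incl : bop (csType W) K :=
  @bop_of R (csType W) K (val : csType W -> K) 1 cs_val_nbounded.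

Variables (V : bop K K) (VW : forall x, cs_pred W x -> cs_pred W (V x)).

Definition cs_restrict_fun (x : csType W) : csType W := CsType (VW (valP x)).

Fact cs_restrict_linear : linear cs_restrict_fun.
Proof. by move=> a x y; apply: val_inj; rewrite /= linearP. Qed.

HB.instance Definition _ := GRing.isLinear.Build _ _ _ _ cs_restrict_fun cs_restrict_linear.

Fact cs_restrict_continuous : continuous cs_restrict_fun.
Proof.
have [M _ hM] := bop_bounded V.
by apply: (@nbounded_continuous R _ _ _ M) => x; apply: (hM (val x)).
Qed.

Definition cs_restrict : bop (csType W) (csType W) := Bop cs_restrict_continuous.

End Restriction.

Lemma commuting_pair (R : realType) (K : hilbertType R) (A B : bop K K) :
  bcommute A B -> commuting [tuple A; B].
Proof. by move=> h [[|[|]]] //= ? [[|[|]]] //= ? x; rewrite !(tnth_nth A) /= h. Qed.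

Lemma extension_pair (R : realType) (H K : hilbertType R) (A B : bop H H)
    (A' B' : bop K K) (J : bop H K) :
  isometric_op J -> (forall x, A' (J x) = J (A x)) -> (forall x, B' (J x) = J (B x)) ->
  is_extension [tuple A; B] [tuple A'; B'] J.
Proof.
move=> iJ hA hB; split=> // -[[|[|]]] //= ? x;
by rewrite (tnth_nth A) (tnth_nth A') /= ?hA ?hB.
Qed.

Section OrthogonalComplement.
Variables (R : realType) (H K : hilbertType R) (J : bop H K).

Lemma adjoint_ker_submod : submod_closed (fun k : K => k \in adjoint J @^-1` [set 0]).
Proof.
split=> [|a u v]; first by apply/mem_set; rewrite /= linear0.
by move=> /set_mem /= hu /set_mem /= hv; apply/mem_set; rewrite /= linearP /= hu hv scaler0 addr0.
Qed.

Lemma adjoint_ker_closed : closed (adjoint J @^-1` [set 0]).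
Proof.
apply: closed_comp; first by move=> x _; apply: adjoint_continuous.
exact/accessible_closed_set1/hausdorff_accessible/norm_hausdorff.
Qed.

(** The orthogonal complement of the copy of [H] in [K]. *)
Definition adjoint_ker : closedSubspace K :=
  ClosedSubspace adjoint_ker_submod adjoint_ker_closed.

Lemma adjoint_kerP k : reflect (adjoint J k = 0) (cs_pred adjoint_ker k).
Proof. by apply: (iffP idP) => [/set_mem|h]; [|apply/mem_set]. Qed.

End OrthogonalComplement.

Section TetrablockIsometry.
Variables (R : realType) (K : hilbertType R) (V : 3.-tuple (bop K K)).
Hypothesis Viso : tetrablock_isometry V.

(** These are the relations of the unitary extension, put in terms of inner products because
    adjoints need not restrict to the invariant subspace. *)
Lemma tetrablock_isometry_relations x y :
  [/\ inner (tnth V 0 x) y = inner (tnth V 2 x) (tnth V 1 y),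
      inner (tnth V 1 x) y = inner (tnth V 2 x) (tnth V 0 y) &
      inner (tnth V 2 x) (tnth V 2 y) = inner x y].
Proof.
have [_ [L [U [J [Uu [iJ hJ]]]]]] := Viso.
split; rewrite -!(isometric_inner _ _ iJ) -!hJ.
- by rewrite (tetrablock_unitary_first Uu) -adjointPr.
- by rewrite (tetrablock_unitary_second Uu) -adjointPr.
- by rewrite adjointP (tetrablock_unitary_third Uu).
Qed.

End TetrablockIsometry.

Lemma normal_extension (R : realType) (K : hilbertType R) (V : 3.-tuple (bop K K)) :
  tetrablock_isometry V ->
  exists (L : hilbertType R) (N1 N2 : bop L L) (J : bop K L),
    [/\ commuting [tuple N1; N2], normal_op N1 /\ normal_op N2,
      is_extension [tuple tnth V 0; tnth V 1] [tuple N1; N2] J &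
      taylor_spectrum [tuple N1; N2] `<=`
        [set z : 2.-tuple R[i] | `|tnth z 0| = `|tnth z 1| /\ `|tnth z 1| <= 1]].
Proof.
move=> [_ [L [U [J [Uu [iJ hJ]]]]]]; have [cU nU _] := Uu.
exists L, (tnth U 0), (tnth U 1), J; split=> //.
- by apply: commuting_pair => x; apply: cU.
- exact: extension_pair.
apply: (pair_taylor_spectrum (nU 0) (nU 1) (cU 0 1)).
(* [|U_0 x| = |U_1^* U_2 x| = |U_1 U_2 x| = |U_2 U_1 x| = |U_1 x|]. *)
- move=> x; rewrite (tetrablock_unitary_first Uu).
  rewrite nr_adjoint; last exact: nU.
  rewrite cU; apply/eqP; rewrite -(@eqrXn2 _ 2) ?nr_ge0 //; apply/eqP.
  by rewrite -!rip_nr /rip adjointP (tetrablock_unitary_third Uu).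
- exact: tetrablock_unitary_second_contraction.
Qed.

(** * Fundamental operators and the isometric lift *)

Section FundamentalOperators.
Variables (R : realType) (H : hilbertType R) (T1 T2 T D : bop H H)
  (F1 F2 : bop (defect_space D) (defect_space D)).
Hypothesis T12 : forall h, T1 (T2 h) = T2 (T1 h).
Hypothesis T1T : forall h, T1 (T h) = T (T1 h).
Hypothesis T2T : forall h, T2 (T h) = T (T2 h).
Hypothesis defD : defect_operator T D.
Hypothesis fundF : fundamental_operators T1 T2 T F1 F2.

Let Dsa x y : inner (D x) y = inner x (D y).
Proof. by case: defD => /positive_selfadjoint. Qed.

Let DD h k : inner (D h) (D k) = inner (h - adjoint T (T h)) k.
Proof. by case: defD => _ <-; rewrite -Dsa. Qed.

Let adj1 k g : inner (adjoint F1 (corestrict D k)) (corestrict D g) =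
  inner (adjoint T1 k - adjoint T (T2 k)) g.
Proof.
rewrite -adjointPr; case: fundF => h1 _.
rewrite -[LHS]/(inner (D k) (val (F1 (corestrict D g)))) Dsa -h1.
by rewrite innerBr innerBl -!adjointPr -adjointP.
Qed.

Let adj2 k g : inner (adjoint F2 (corestrict D k)) (corestrict D g) =
  inner (adjoint T2 k - adjoint T (T1 k)) g.
Proof.
rewrite -adjointPr; case: fundF => _ h2.
rewrite -[LHS]/(inner (D k) (val (F2 (corestrict D g)))) Dsa -h2.
by rewrite innerBr innerBl -!adjointPr -adjointP.
Qed.

Let inner_fund1 h g : inner (F1 (corestrict D h)) (corestrict D g) =
  inner (T1 h - adjoint T2 (T h)) g.
Proof.
rewrite -[LHS]/(inner (val (F1 (corestrict D h))) (D g)) -Dsa.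
by case: fundF => /(_ h) ->.
Qed.

Let inner_fund2 h g : inner (F2 (corestrict D h)) (corestrict D g) =
  inner (T2 h - adjoint T1 (T h)) g.
Proof.
rewrite -[LHS]/(inner (val (F2 (corestrict D h))) (D g)) -Dsa.
by case: fundF => _ /(_ h) ->.
Qed.

Section Kernel.
Variable h : H.
Hypothesis Dh : D h = 0.

Let ch : corestrict D h = 0.
Proof. exact: val_inj. Qed.

Let T1E : adjoint T2 (T h) = T1 h.
Proof.
by case: fundF => /(_ h) + _; rewrite ch !linear0 => /eqP; rewrite subr_eq0 => /eqP.
Qed.

Let T2E : adjoint T1 (T h) = T2 h.
Proof.
by case: fundF => _ /(_ h); rewrite ch !linear0 => /eqP; rewrite subr_eq0 => /eqP.
Qed.

Let adjT12 x : adjoint T1 (adjoint T2 x) = adjoint T2 (adjoint T1 x).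
Proof. by apply: inner_ext => y; rewrite -!adjointP T12. Qed.

(** Tested against [D g], the sides are [T1^* T1 h - T^* T2 T1 h] and [T2^* T2 h - T^* T1 T2 h]. On
    the kernel both leading terms equal [T1^* T2^* T h]. *)
Lemma fundamental_ker_first :
  adjoint F1 (corestrict D (T1 h)) = adjoint F2 (corestrict D (T2 h)).
Proof.
apply: corestrict_inner_ext => g; rewrite adj1 adj2.
by rewrite -{1}T1E adjT12 T2E T12.
Qed.

Lemma fundamental_ker_second :
  adjoint F1 (adjoint F2 (corestrict D (T h))) = adjoint F2 (adjoint F1 (corestrict D (T h))).
Proof.
(* Here [T2^* T h - T^* T1 T h = T1 h - T^* T T1 h], which is [D D T1 h]. *)
have -> : adjoint F2 (corestrict D (T h)) = corestrict D (T1 h).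
  apply: corestrict_inner_ext => g; rewrite adj2 T1E T1T.
  by rewrite -[RHS]/(inner (D (T1 h)) (D g)) DD.
have -> : adjoint F1 (corestrict D (T h)) = corestrict D (T2 h).
  apply: corestrict_inner_ext => g; rewrite adj1 T2E T2T.
  by rewrite -[RHS]/(inner (D (T2 h)) (D g)) DD.
exact: fundamental_ker_first.
Qed.

End Kernel.

Section Dilation.
Variables (K : hilbertType R) (V : 3.-tuple (bop K K)) (J : bop H K).
Hypotheses (Viso : tetrablock_isometry V) (iJ : isometric_op J).
Hypothesis lift : forall i h,
  adjoint (tnth V i) (J h) = J (adjoint (tnth [tuple T1; T2; T] i) h).

Let W := adjoint_ker J.

(** The lift condition says [J^* V_i = T_i J^*], so the kernel of [J^*] is invariant. *)
Let VW i x : cs_pred W x -> cs_pred W (tnth V i x).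
Proof.
move=> /adjoint_kerP hx; apply/adjoint_kerP/inner_ext => h.
by rewrite -adjointP adjointPr lift adjointP hx !inner0r.
Qed.

Let JV i h : adjoint J (tnth V i (J h)) = tnth [tuple T1; T2; T] i h.
Proof.
apply: inner_ext => g.
by rewrite -adjointP adjointPr lift isometric_inner // -adjointPr.
Qed.

Let proj_mem k : cs_pred W (k - J (adjoint J k)).
Proof. by apply/adjoint_kerP; rewrite linearB /= isometric_adjointK // subrr. Qed.

Let G h : csType W := CsType (proj_mem (tnth V 2 (J h))).

Let Glin : linear G.
Proof.
move=> a x y; apply: val_inj => /=; rewrite (linearP J) (linearP (tnth V 2)) (linearP (adjoint J)) (linearP J) scalerBr opprD.
by rewrite addrACA.
Qed.

HB.instance Definition _ := GRing.isLinear.Build _ _ _ _ G Glin.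

Let GE h : val (G h) = tnth V 2 (J h) - J (T h).
Proof. by rewrite /= JV. Qed.

Let inner_W (x : K) h : cs_pred W x -> inner x (val (G h)) = inner x (tnth V 2 (J h)).
Proof.
by move=> /adjoint_kerP hx; rewrite GE innerBr (adjointPr J) hx inner0l subr0.
Qed.

(** By orthogonality [|G h|^2 = |V_2 J h|^2 - |T h|^2 = |h|^2 - |T h|^2], as [V_2] is isometric. *)
Let GD h : nr (G h) = nr (D h).
Proof.
apply/eqP; rewrite -(@eqrXn2 _ 2) ?nr_ge0 //; apply/eqP.
rewrite -!rip_nr /rip DD -[inner (G h) _]/(inner (val (G h)) (val (G h))).
rewrite inner_W; last exact: proj_mem.
have [_ _ e] := tetrablock_isometry_relations Viso (J h) (J h).
rewrite GE !innerBl e isometric_inner // adjointP JV.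
by rewrite -adjointPr.
Qed.

(** Since [V_i] preserves the complement, [G g] may be replaced by [V_2 J g]. In
    [V_i G h = V_2 V_i J h - V_i J T h] the first term yields [T_i h] because [V_2] is isometric,
    and the second yields [T_j^* T h] through [rel]. *)
Let inner_compression i j h g :
  (forall u v, inner (tnth V j u) v = inner (tnth V 2 u) (tnth V i v)) ->
  inner (tnth V i (val (G h))) (val (G g)) =
  inner (tnth [tuple T1; T2; T] i h - adjoint (tnth [tuple T1; T2; T] j) (T h)) g.
Proof.
move=> rel; rewrite inner_W; last exact/VW/proj_mem.
have [cV _] := Viso.
rewrite GE linearB !innerBl cV.
have [_ _ ->] := tetrablock_isometry_relations Viso (tnth V i (J h)) (J g).
rewrite adjointPr JV; congr (_ - _).
by rewrite innerC -rel adjointPr JV -innerC -adjointPr.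
Qed.

Lemma fundamental_dilation :
  exists (F : hilbertType R) (Lam : bop (defect_space D) F) (S1 S2 : bop F F)
    (I : bop F K),
  [/\ isometric_op Lam, commuting [tuple S1; S2],
    (forall x, F1 x = adjoint Lam (S1 (Lam x))) /\
    (forall x, F2 x = adjoint Lam (S2 (Lam x))) &
    is_extension [tuple S1; S2] [tuple tnth V 0; tnth V 1] I].
Proof.
have [Lam [iL LG]] := isometric_extension GD.
pose S1 := cs_restrict (@VW 0); pose S2 := cs_restrict (@VW 1).
have [cV _] := Viso.
exists (csType W), Lam, S1, S2, (cs_incl W); split=> //.
- by apply: commuting_pair => x; apply: val_inj => /=; apply: cV.
- have rel := tetrablock_isometry_relations Viso.
  split=> x.
    apply: (corestrict_bop_ext (A := F1) (B := bcomp (adj Lam) (bcomp S1 Lam))) => h g.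
    rewrite inner_fund1 -[RHS]/(inner (adjoint Lam (S1 (Lam (corestrict D h)))) (corestrict D g)).
    rewrite -adjointPr !LG; symmetry; apply: (@inner_compression 0 1) => u v.
    by have [_ + _] := rel u v.
  apply: (corestrict_bop_ext (A := F2) (B := bcomp (adj Lam) (bcomp S2 Lam))) => h g.
  rewrite inner_fund2 -[RHS]/(inner (adjoint Lam (S2 (Lam (corestrict D h)))) (corestrict D g)).
    rewrite -adjointPr !LG; symmetry; apply: (@inner_compression 1 0) => u v.
  by have [+ _ _] := rel u v.
- exact: extension_pair.
Qed.

End Dilation.
End FundamentalOperators.

Theorem proposition2p3 (R : realType) (H : hilbertType R)
    (T1 T2 T D : bop H H) (F1 F2 : bop (defect_space D) (defect_space D)) :
  tetrablock_contraction [tuple T1; T2; T] ->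
  defect_operator T D ->
  fundamental_operators T1 T2 T F1 F2 ->
  has_tetrablock_isometric_lift [tuple T1; T2; T] ->
  [/\ exists (F : hilbertType R) (Lam : bop (defect_space D) F)
        (S1 S2 : bop F F),
        [/\ isometric_op Lam,
            commuting [tuple S1; S2],
            (forall x, F1 x = adjoint Lam (S1 (Lam x))) /\
            (forall x, F2 x = adjoint Lam (S2 (Lam x))) &
            exists (K : hilbertType R) (N1 N2 : bop K K) (J : bop F K),
              [/\ commuting [tuple N1; N2],
                  normal_op N1 /\ normal_op N2,
                  is_extension [tuple S1; S2] [tuple N1; N2] J &
                  taylor_spectrum [tuple N1; N2] `<=`
                    [set z : 2.-tuple R[i] |
                      `|tnth z 0| = `|tnth z 1| /\ `|tnth z 1| <= 1]]],
      forall h : H, D h = 0 ->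
        adjoint F1 (corestrict D (T1 h)) - adjoint F2 (corestrict D (T2 h)) = 0 &
      forall h : H, D h = 0 ->
        adjoint F1 (adjoint F2 (corestrict D (T h))) -
        adjoint F2 (adjoint F1 (corestrict D (T h))) = 0].
Proof.
move=> [cT _] defD fund [K [V [J [Viso iJ lift]]]].
have T12 h : T1 (T2 h) = T2 (T1 h) by exact: (cT 0 1).
have T1T h : T1 (T h) = T (T1 h) by exact: (cT 0 2).
have T2T h : T2 (T h) = T (T2 h) by exact: (cT 1 2).
split=> [|h Dh|h Dh].
- have [F [Lam [S1 [S2 [I [iL cS FS [iI hI]]]]]]] :=
    fundamental_dilation defD fund Viso iJ lift.
  have [L [N1 [N2 [J' [cN nN [iJ' hJ'] sN]]]]] := normal_extension Viso.
  exists F, Lam, S1, S2; split=> //.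
  exists L, N1, N2, (bcomp J' I); split=> //; split=> [x|i x] /=.
    by rewrite iJ' iI.
  by rewrite hJ' hI.
- by apply/eqP; rewrite subr_eq0; apply/eqP; apply: (fundamental_ker_first T12 defD fund Dh).
- by apply/eqP; rewrite subr_eq0; apply/eqP; apply: (fundamental_ker_second T12 T1T T2T defD fund Dh).
Qed.
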